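(* Let $B$ be a bialgebra over a field $\mathbb{K}$ and let $\mathsf{d}:B\to B$ be a derivation satisfying $\Delta(\mathsf{d}(b))=\mathsf{d}(b_{(1)})\otimes_{\mathbb{K}}b_{(2)}+b_{(1)}\otimes_{\mathbb{K}}\mathsf{d}(b_{(2)})$ and $\epsilon(\mathsf{d}(b))=0$ for all $b\in B$. Let $H=B[x;\mathsf{d}]$ be the Ore extension of $B$. Then $H$ is a bialgebra (with coalgebra structure extending that of $B$ and $\Delta(x)=x\otimes 1+1\otimes x$, $\epsilon(x)=0$), the natural algebra map $f:B\to H$, $b\mapsto b$, is a bialgebra map, and $f$ induces a left Hopf monad ${}_{B}H\otimes_B-$ on the monoidal category ${}_{B}\mathcal{M}$ of left $B$-modules.
   Context: The Ore extension $B[x;\mathsf{d}]$ is the quotient of the algebra $B\langle x\rangle$ freely generated over $B$ by $x$, by the two-sided ideal generated by $\{xb-bx-\mathsf{d}(b)\mid b\in B\}$. Sweedler notation $\Delta(b)=b_{(1)}\otimes b_{(2)}$ is used. ${}_{B}\mathcal{M}$ is monoidal under $\otimes_{\mathbb{K}}$ with diagonal action via $\Delta_B$ and unit $\mathbb{K}$ (action via $\epsilon_B$). For a bialgebra map $f:B\to H$, $H$ is a $B$-bimodule via $f$, and $T(M)={}_{B}H\otimes_B M$ is the monad on ${}_{B}\mathcal{M}$ of the adjunction (extension of scalars) $\dashv$ (restriction of scalars): multiplication $h\otimes_B(h'\otimes_B m)\mapsto hh'\otimes_B m$, unit $m\mapsto 1_H\otimes_B m$. It is a bimonad with $T_2(M,N)(h\otimes_B(m\otimes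 n))=(h_{(1)}\otimes_B m)\otimes(h_{(2)}\otimes_B n)$ and $T_0:H\otimes_B\mathbb{K}\to\mathbb{K}$ induced by $\epsilon_H$. A bimonad $(T,\mu,\eta,T_2,T_0)$ is left Hopf if all left fusion operators $H^l_{X,Y}=(\mathrm{id}_{T(X)}\otimes\mu_Y)T_2(X,T(Y)):T(X\otimes T(Y))\to T(X)\otimes T(Y)$ are invertible. *)

(* Defs.v *)
From HB Require Import structures.
From mathcomp Require Import all_boot all_order all_algebra.
From mathcomp Require Import generic_quotient boolp freeg.

Set Implicit Arguments.
Unset Strict Implicit.
Unset Printing Implicit Defensive.

Import GRing.Theory.
Local Open Scope ring_scope.
Local Open Scope quotient_scope.

Local Notation bilin f := (bilinear_for *:%R *:%R f).

Definition mklinear (R : pzRingType) (U V : lmodType R) (f : U -> V)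
    (fL : linear f) : {linear U -> V} :=
  HB.pack f (GRing.isLinear.Build R U V *:%R f fL).

Lemma linear_ext (R : pzRingType) (U V : lmodType R) (f g : {linear U -> V}) :
  (forall u, f u = g u) -> f = g.
Proof.
move=> fg; have : f = g :> (U -> V) by apply/funext.
case: f g {fg} => [f [[fa] [fs]]] [g [[ga] [gs]]] /= fg.
move: fa fs; rewrite fg => fa fs.
by rewrite (Prop_irrelevance fa ga) (Prop_irrelevance fs gs).
Qed.

(* Quotient of a module by the submodule spanned by a set of relators. *)
Section QuotientModule.
Variables (R : nzRingType) (V : lmodType R) (S : V -> Prop).

Inductive lspan : V -> Prop :=
| lspan0 : lspan 0
| lspan_lin a u v : S u -> lspan v -> lspan (a *: u + v).

Lemma lspan_gen u : S u -> lspan u.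
Proof. by move=> Su; rewrite -[u]scale1r -[X in lspan X]addr0; apply: lspan_lin => //; exact: lspan0. Qed.

Lemma lspanD u v : lspan u -> lspan v -> lspan (u + v).
Proof.
move=> su sv; elim: su => [|a w w' Sw _ IH]; first by rewrite add0r.
by rewrite -addrA; apply: lspan_lin.
Qed.

Lemma lspanZ a u : lspan u -> lspan (a *: u).
Proof.
elim=> [|b w w' Sw _ IH]; first by rewrite scaler0; exact: lspan0.
by rewrite scalerDr scalerA; apply: lspan_lin.
Qed.

Lemma lspanN u : lspan u -> lspan (- u).
Proof. by rewrite -scaleN1r; exact: lspanZ. Qed.

Definition qrel (u v : V) : bool := `[< lspan (u - v) >].

Lemma qrel_refl : reflexive qrel.
Proof. by move=> u; apply/asboolP; rewrite subrr; exact: lspan0. Qed.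

Lemma qrel_sym : symmetric qrel.
Proof.
by move=> u v; apply/asboolP/asboolP => /lspanN; rewrite opprB.
Qed.

Lemma qrel_trans : transitive qrel.
Proof.
move=> v u w /asboolP uv /asboolP vw; apply/asboolP.
by have := lspanD uv vw; rewrite addrA subrK.
Qed.

Canonical qrel_equiv := EquivRel qrel qrel_refl qrel_sym qrel_trans.

Definition quotmod := {eq_quot qrel}.

HB.instance Definition _ := Choice.on quotmod.
HB.instance Definition _ := EqQuotient.on quotmod.

Definition qpi (v : V) : quotmod := \pi_quotmod v.

Lemma qpiP u v : qpi u = qpi v <-> lspan (u - v).
Proof.
split=> [/eqP|uv]; first by rewrite /qpi (eqmodE qrel_equiv) => /asboolP.
by apply/eqP; rewrite /qpi (eqmodE qrel_equiv); apply/asboolP.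
Qed.

Lemma qpi_surj (P : quotmod -> Prop) : (forall v, P (qpi v)) -> forall x, P x.
Proof. by move=> H x; rewrite -[x]reprK; exact: H. Qed.

Lemma lspan_repr v : lspan (repr (qpi v) - v).
Proof. by apply/qpiP; rewrite /qpi reprK. Qed.

Let qadd (x y : quotmod) := qpi (repr x + repr y).
Let qopp (x : quotmod) := qpi (- repr x).
Let qscale a (x : quotmod) := qpi (a *: repr x).

Let qpiD u v : qadd (qpi u) (qpi v) = qpi (u + v).
Proof. by apply/qpiP; rewrite opprD addrACA; apply: lspanD; exact: lspan_repr. Qed.
Let qpiN u : qopp (qpi u) = qpi (- u).
Proof. by apply/qpiP; rewrite -opprD; apply: lspanN; exact: lspan_repr. Qed.
Let qpiZ a u : qscale a (qpi u) = qpi (a *: u).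
Proof. by apply/qpiP; rewrite -scalerBr; apply: lspanZ; exact: lspan_repr. Qed.

Fact qaddA : associative qadd.
Proof. by do 3![elim/qpi_surj => ?]; rewrite !qpiD addrA. Qed.
Fact qaddC : commutative qadd.
Proof. by do 2![elim/qpi_surj => ?]; rewrite !qpiD addrC. Qed.
Fact qadd0 : left_id (qpi 0) qadd.
Proof. by elim/qpi_surj => ?; rewrite qpiD add0r. Qed.
Fact qaddN : left_inverse (qpi 0) qopp qadd.
Proof. by elim/qpi_surj => ?; rewrite qpiN qpiD addNr. Qed.

HB.instance Definition _ := GRing.isZmodule.Build quotmod qaddA qaddC qadd0 qaddN.

Fact qscaleA a b x : qscale a (qscale b x) = qscale (a * b) x.
Proof. by elim/qpi_surj: x => ?; rewrite !qpiZ scalerA. Qed.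
Fact qscale1 : left_id 1 qscale.
Proof. by elim/qpi_surj => ?; rewrite qpiZ scale1r. Qed.
Fact qscaleDr : right_distributive qscale +%R.
Proof.
move=> a; do 2![elim/qpi_surj => ?].
by rewrite /GRing.add /= qpiD !qpiZ scalerDr qpiD.
Qed.
Fact qscaleDl x : {morph qscale^~ x : a b / a + b}.
Proof. by move=> a b /=; elim/qpi_surj: x => ?; rewrite !qpiZ scalerDl -qpiD. Qed.

HB.instance Definition _ :=
  GRing.Zmodule_isLmodule.Build R quotmod qscaleA qscale1 qscaleDr qscaleDl.

Fact qpi_is_linear : linear qpi.
Proof. by move=> a u v; rewrite -qpiD -qpiZ. Qed.
HB.instance Definition _ := GRing.isLinear.Build R V quotmod *:%R qpi qpi_is_linear.

Lemma qpi_eq0 u : S u -> qpi u = 0.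
Proof. by move=> Su; apply/qpiP; rewrite subr0; exact: lspan_gen. Qed.

(* [qlift f] is the map induced by [f]; it is meaningful only when [f] is
   linear and vanishes on the relators. *)
Definition qlift (T : Type) (f : V -> T) (x : quotmod) : T := f (repr x).

Lemma qliftE (W : lmodType R) (f : V -> W) : linear f ->
  (forall u, S u -> f u = 0) -> forall v, qlift f (qpi v) = f v.
Proof.
move=> fL f0 v; pose g := mklinear fL.
have sg u : lspan u -> g u = 0.
  by elim=> [|a w w' Sw _ IH]; rewrite ?linear0 // linearP IH addr0 [g w]f0 // scaler0.
by apply/eqP; rewrite -subr_eq0 -[_ - _]/(g _ - g _) -linearB sg //; exact: lspan_repr.
Qed.

Lemma qlift_linear (W : lmodType R) (f : V -> W) : linear f ->
  (forall u, S u -> f u = 0) -> linear (qlift f).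
Proof.
move=> fL f0 a; elim/qpi_surj => u; elim/qpi_surj => v.
by rewrite -[a *: _ + _]qpi_is_linear !qliftE //; exact: fL.
Qed.
End QuotientModule.

Lemma fglift_linear (R : nzRingType) (T : choiceType) (W : lmodType R) (f : T -> W) :
  linear (fglift f : {freeg T / R} -> W).
Proof.
have fglB : {morph fglift f : x y / x - y} := @lift_is_additive R T W f.
pose g : {additive {freeg T / R} -> W} :=
  HB.pack (fglift f) (GRing.isZmodMorphism.Build _ _ (fglift f) fglB).
have gZ c D : g (c *: D) = c *: g D.
  rewrite -[D]freeg_sumE scaler_sumr !raddf_sum /=.
  apply: eq_bigr => x _ /=; set k := coeff x D.
  suff -> : c *: << k *g x >> = << c * k *g x >> :> {freeg T / R}.
    by rewrite !liftU scalerA.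
  by apply/eqP/freeg_eqP => y; rewrite coeffZ !coeffU mulrA.
by move=> a u v; rewrite -[fglift f]/(g : _ -> _) raddfD /= -gZ.
Qed.

Lemma freeg_eq_linear (R : nzRingType) (T : choiceType) (W : lmodType R)
    (f g : {linear {freeg T / R} -> W}) :
  (forall x, f << x >> = g << x >>) -> forall D, f D = g D.
Proof.
move=> fg D; rewrite -[D]freeg_sumE !linear_sum; apply: eq_bigr => x _.
have -> : << coeff x D *g x >> = coeff x D *: << x >> :> {freeg T / R}.
  by apply/eqP/freeg_eqP => y; rewrite coeffZ !coeffU mul1r.
by rewrite !linearZ /= fg.
Qed.

Section Tensor.
Variable K : fieldType.

Section Construction.
Variables U V : lmodType K.

Inductive tensor_rel : {freeg (U * V) / K} -> Prop :=
| tensor_rel_l a u u' v : tensor_rel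
    (<< (a *: u + u', v) >> - (a *: << (u, v) >> + << (u', v) >>))
| tensor_rel_r a u v v' : tensor_rel
    (<< (u, a *: v + v') >> - (a *: << (u, v) >> + << (u, v') >>)).

Definition tensor : Type := quotmod tensor_rel.
HB.instance Definition _ := GRing.Lmodule.on tensor.

Definition pure (u : U) (v : V) : tensor := qpi tensor_rel << (u, v) >>.

Lemma pure_bilinear : bilin pure.
Proof.
split=> [v a u u'|u a v v'] /=; rewrite /pure -linearP; apply/qpiP/lspan_gen.
  exact: tensor_rel_l.
exact: tensor_rel_r.
Qed.

Lemma tensor_ext (W : lmodType K) (f g : tensor -> W) : linear f -> linear g ->
  (forall u v, f (pure u v) = g (pure u v)) -> forall t, f t = g t.
Proof.
move=> fL gL fg; elim/qpi_surj.
pose F := mklinear fL; pose G := mklinear gL.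
apply: (@freeg_eq_linear _ _ _ (F \o @qpi _ _ tensor_rel) (G \o @qpi _ _ tensor_rel)).
by case=> u v; exact: fg.
Qed.

Lemma tensor_ind (P : tensor -> Prop) :
  (forall u v, P (pure u v)) -> (forall a s t, P s -> P t -> P (a *: s + t)) ->
  forall t, P t.
Proof.
move=> Pp Pl; elim/qpi_surj => D; rewrite -[D]freeg_sumE.
have P0 : P 0.
  have := Pl (-1) _ _ (Pp 0 0) (Pp 0 0); by rewrite scaleN1r addNr.
rewrite linear_sum; elim: (dom D) => [|x s IH]; first by rewrite big_nil.
rewrite big_cons.
have -> : << coeff x D *g x >> = coeff x D *: << x >> :> {freeg _ / K}.
  by apply/eqP/freeg_eqP => y; rewrite coeffZ !coeffU mul1r.
by rewrite linearZ; apply: Pl => //; case: x.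
Qed.

(* Map induced by [f]; meaningful only when [f] is bilin. *)
Definition tlift (W : lmodType K) (f : U -> V -> W) : tensor -> W :=
  @qlift _ _ tensor_rel W (fglift (fun p => f p.1 p.2)).

Section Lift.
Variables (W : lmodType K) (f : U -> V -> W).
Hypothesis fB : bilin f.

Let f0 u : tensor_rel u -> fglift (fun p => f p.1 p.2) u = 0.
Proof.
pose g := mklinear (@fglift_linear K _ W (fun p : U * V => f p.1 p.2)).
by case=> a *; rewrite -[LHS]/(g _) linearB linearP /= !liftU !scale1r /= (fB.1, fB.2) subrr.
Qed.

Lemma tlift_linear : linear (tlift f).
Proof. exact: (qlift_linear (@fglift_linear _ _ _ _) f0). Qed.

Lemma tliftE u v : tlift f (pure u v) = f u v.
Proof.
by rewrite /tlift (qliftE (@fglift_linear _ _ _ _) f0) liftU scale1r.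
Qed.
End Lift.
End Construction.
End Tensor.

Section TensorMaps.
Variable K : fieldType.

Definition tlin (U V W : lmodType K) (f : U -> V -> W) (fB : bilin f) :
  {linear tensor U V -> W} := mklinear (tlift_linear fB).

Lemma tlinE (U V W : lmodType K) (f : U -> V -> W) (fB : bilin f) u v :
  tlin fB (pure u v) = f u v.
Proof. exact: tliftE. Qed.

Lemma purePl (U V : lmodType K) a (u u' : U) (v : V) :
  pure (a *: u + u') v = a *: pure u v + pure u' v.
Proof. exact: (pure_bilinear U V).1. Qed.
Lemma purePr (U V : lmodType K) a (u : U) (v v' : V) :
  pure u (a *: v + v') = a *: pure u v + pure u v'.
Proof. exact: (pure_bilinear U V).2. Qed.

Lemma comb_swap (V : lmodType K) c k (x y z w : V) :
  c *: (k *: x + y) + (k *: z + w) = k *: (c *: x + z) + (c *: y + w).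
Proof. by rewrite !scalerDr !scalerA [c * k]mulrC addrACA. Qed.

(* Dependence of [tlift] on a parameter. *)
Lemma tlift_param (U V W T : lmodType K) (F : T -> U -> V -> W) :
  (forall w, bilin (F w)) -> (forall u v, linear (fun w => F w u v)) ->
  forall t, linear (fun w => tlift (F w) t).
Proof.
move=> FB FL t a w w'.
elim/tensor_ind: t => [u v|b s t IHs IHt]; first by rewrite !tliftE // FL.
have tL w0 := tlift_linear (FB w0).
by rewrite !tL IHs IHt comb_swap.
Qed.

Fact tmap_bilinear (U V U' V' : lmodType K)
    (f : {linear U -> U'}) (g : {linear V -> V'}) :
  bilin (fun u v => pure (f u) (g v)).
Proof. by split=> [v a u u'|u a v v']; rewrite linearP (purePl, purePr). Qed.

Definition tmap (U V U' V' : lmodType K)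
    (f : {linear U -> U'}) (g : {linear V -> V'}) :
  {linear tensor U V -> tensor U' V'} := tlin (tmap_bilinear f g).

Lemma tmapE (U V U' V' : lmodType K) (f : {linear U -> U'})
  (g : {linear V -> V'}) u v : tmap f g (pure u v) = pure (f u) (g v).
Proof. exact: tlinE. Qed.

Section Assoc.
Variables U V W : lmodType K.

Fact pureA_bilinear w : bilin (fun (u : U) (v : V) => pure u (pure v (w : W))).
Proof. by split=> [v a u u'|u a v v']; rewrite ?(purePl, purePr). Qed.
Fact tassoc_bilinear :
  bilin (fun t w => tlift (fun (u : U) (v : V) => pure u (pure v (w : W))) t).
Proof.
split=> [w|t]; first exact/tlift_linear/pureA_bilinear.
by apply: tlift_param => [w|u v a w w']; [exact: pureA_bilinear|rewrite !purePr].
Qed.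
Definition tassoc : {linear tensor (tensor U V) W -> tensor U (tensor V W)} :=
  tlin tassoc_bilinear.
Lemma tassocE u v w : tassoc (pure (pure u v) w) = pure u (pure v w).
Proof. by rewrite tlinE tliftE //; exact: pureA_bilinear. Qed.

Fact pureAV_bilinear u : bilin (fun (v : V) (w : W) => pure (pure (u : U) v) w).
Proof. by split=> [w a v v'|v a w w']; rewrite ?(purePl, purePr). Qed.
Fact tassocV_bilinear :
  bilin (fun u t => tlift (fun (v : V) (w : W) => pure (pure (u : U) v) w) t).
Proof.
split=> [t|u]; last exact/tlift_linear/pureAV_bilinear.
by apply: tlift_param => [u|v w a u u']; [exact: pureAV_bilinear|rewrite !purePl].
Qed.
Definition tassocV : {linear tensor U (tensor V W) -> tensor (tensor U V) W} :=
  tlin tassocV_bilinear.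
Lemma tassocVE u v w : tassocV (pure u (pure v w)) = pure (pure u v) w.
Proof. by rewrite tlinE tliftE //; exact: pureAV_bilinear. Qed.

Lemma tassocK : cancel tassoc tassocV.
Proof.
elim/tensor_ind => [t w|a s t IHs IHt]; last by rewrite !linearP IHs IHt.
elim/tensor_ind: t => [u v|a s t IHs IHt]; first by rewrite tassocE tassocVE.
by rewrite purePl !linearP IHs IHt.
Qed.
Lemma tassocVK : cancel tassocV tassoc.
Proof.
elim/tensor_ind => [u t|a s t IHs IHt]; last by rewrite !linearP IHs IHt.
elim/tensor_ind: t => [v w|a s t IHs IHt]; first by rewrite tassocVE tassocE.
by rewrite purePr !linearP IHs IHt.
Qed.
End Assoc.

Section Unit.
Variable V : lmodType K.

Fact tlunit_bilinear : bilin (fun (k : K^o) (v : V) => (k : K) *: v).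
Proof.
split=> [v a k k'|k a v v'].
  by rewrite /= scalerA -scalerDl.
by rewrite /= scalerDr !scalerA [a * k]mulrC.
Qed.
Definition tlunit : {linear tensor K^o V -> V} := tlin tlunit_bilinear.
Lemma tlunitE k v : tlunit (pure k v) = k *: v.
Proof. exact: tlinE. Qed.

Fact trunit_bilinear : bilin (fun (v : V) (k : K^o) => (k : K) *: v).
Proof. by split; [exact: tlunit_bilinear.2 | exact: tlunit_bilinear.1]. Qed.
Definition trunit : {linear tensor V K^o -> V} := tlin trunit_bilinear.
Lemma trunitE k v : trunit (pure v k) = k *: v.
Proof. exact: tlinE. Qed.

Definition tlunitV : {linear V -> tensor K^o V} :=
  mklinear ((pure_bilinear K^o V).2 1).
Definition trunitV : {linear V -> tensor V K^o} :=
  mklinear ((pure_bilinear V K^o).1 1).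

Lemma tlunitVE v : tlunitV v = pure (1 : K^o) v. Proof. by []. Qed.
Lemma trunitVE v : trunitV v = pure v (1 : K^o). Proof. by []. Qed.

Lemma pureZl (U W : lmodType K) a (u : U) (w : W) : pure (a *: u) w = a *: pure u w.
Proof. exact: (linearZ_LR (mklinear ((pure_bilinear U W).1 w))). Qed.
Lemma pureZr (U W : lmodType K) a (u : U) (w : W) : pure u (a *: w) = a *: pure u w.
Proof. exact: (linearZ_LR (mklinear ((pure_bilinear U W).2 u))). Qed.

Lemma tlunitK : cancel tlunit tlunitV.
Proof.
elim/tensor_ind => [k v|a s t IHs IHt]; last by rewrite !linearP IHs IHt.
by rewrite tlunitE tlunitVE pureZr -pureZl /GRing.scale /= mulr1.
Qed.
Lemma tlunitVK : cancel tlunitV tlunit.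
Proof. by move=> v; rewrite tlunitVE tlunitE scale1r. Qed.
Lemma trunitK : cancel trunit trunitV.
Proof.
elim/tensor_ind => [v k|a s t IHs IHt]; last by rewrite !linearP IHs IHt.
by rewrite trunitE trunitVE pureZl -pureZr /GRing.scale /= mulr1.
Qed.
Lemma trunitVK : cancel trunitV trunit.
Proof. by move=> v; rewrite trunitVE trunitE scale1r. Qed.
End Unit.
End TensorMaps.

(* Left modules over a K-algebra, as K-spaces with a bilinear action: this
   keeps both the K-scaling and the A-action available on the carrier. *)
Record amod (K : fieldType) (A : algType K) := AMod {
  amod_car :> lmodType K;
  act : A -> amod_car -> amod_car;
  act_bilinear : bilin act;
  act1 : forall m, act 1 m = m;
  actM : forall a b m, act (a * b) m = act a (act b m)
}.

Section Modules.
Variable K : fieldType.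

Definition actl (A : algType K) (M : amod A) (a : A) : {linear M -> M} :=
  mklinear ((act_bilinear M).2 a).

Lemma actlE (A : algType K) (M : amod A) a (m : M) : actl M a m = act a m.
Proof. by []. Qed.

Lemma actPl (A : algType K) (M : amod A) k (a b : A) (m : M) :
  act (k *: a + b) m = k *: act a m + act b m.
Proof. exact: (act_bilinear M).1. Qed.
Lemma actPr (A : algType K) (M : amod A) k (a : A) (m n : M) :
  act a (k *: m + n) = k *: act a m + act a n.
Proof. exact: (act_bilinear M).2. Qed.

Lemma actZl (A : algType K) (M : amod A) k (a : A) (m : M) :
  act (k *: a) m = k *: act a m.
Proof. exact: (linearZ_LR (mklinear ((act_bilinear M).1 m))). Qed.
Lemma actZr (A : algType K) (M : amod A) k (a : A) (m : M) :
  act a (k *: m) = k *: act a m.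
Proof. exact: (linearZ_LR (actl M a)). Qed.

Fact mul_bilinear (A : algType K) : bilin (fun a b : A => a * b).
Proof.
split=> [v a u u'|u a v v']; first by rewrite /= mulrDl scalerAl.
by rewrite /= mulrDr scalerAr.
Qed.
Definition regular (A : algType K) : amod A :=
  AMod (mul_bilinear A) (@mul1r A) (fun a b m => esym (mulrA a b m)).

(* The action of A (x) A' on X (x) Y: (a (x) a') (x (x) y) = ax (x) a'y. *)
Section ProductAction.
Variables (A A' : algType K) (X : amod A) (Y : amod A').

Definition pact (z : tensor A A') (t : tensor X Y) : tensor X Y :=
  tlift (fun a a' => tmap (actl X a) (actl Y a') t) z.

Fact pact_subproof t : bilin (fun a a' => tmap (actl X a) (actl Y a') t).
Proof.
split=> [a' k a b|a k a' b']; cbv beta;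
  (elim/tensor_ind: t => [u v|c s t IHs IHt];
   [by rewrite !tmapE !actlE actPl (purePl, purePr)|]);
  by rewrite !linearP IHs IHt comb_swap.
Qed.

Lemma pactE a a' t : pact (pure a a') t = tmap (actl X a) (actl Y a') t.
Proof. exact: (tliftE (pact_subproof t)). Qed.

Lemma pact_pure a a' x y : pact (pure a a') (pure x y) = pure (act a x) (act a' y).
Proof. by rewrite pactE tmapE !actlE. Qed.

Lemma pact_bilinear : bilin pact.
Proof.
split=> [t|z]; first exact/tlift_linear/pact_subproof.
by apply: tlift_param => [t|a a']; [exact: pact_subproof|exact: linearP].
Qed.
Lemma pactPl k z z' t : pact (k *: z + z') t = k *: pact z t + pact z' t.
Proof. exact: pact_bilinear.1. Qed.
Lemma pactPr k z t t' : pact z (k *: t + t') = k *: pact z t + pact z t'.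
Proof. exact: pact_bilinear.2. Qed.

Lemma pact1 t : pact (pure 1 1) t = t.
Proof.
elim/tensor_ind: t => [x y|a s t IHs IHt]; first by rewrite pact_pure !act1.
by rewrite pactPr IHs IHt.
Qed.
End ProductAction.

Section TensorRing.
Variables A A' : algType K.

Definition tmul (s t : tensor A A') : tensor A A' :=
  @pact A A' (regular A) (regular A') s t.

Lemma tmulE a a' b b' : tmul (pure a a') (pure b b') = pure (a * b) (a' * b').
Proof. exact: (@pact_pure A A' (regular A) (regular A')). Qed.

Lemma pactM (X : amod A) (Y : amod A') z z' (t : tensor X Y) :
  pact (tmul z z') t = pact z (pact z' t).
Proof.
elim/tensor_ind: z => [a a'|k z1 z2 IH1 IH2]; last first.
  by rewrite /tmul pactPl !pactPl IH1 IH2.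
elim/tensor_ind: z' => [b b'|k z1 z2 IH1 IH2]; last first.
  by rewrite /tmul pactPr !pactPl pactPr IH1 IH2.
elim/tensor_ind: t => [x y|k t1 t2 IH1 IH2]; last by rewrite !pactPr IH1 IH2.
by rewrite tmulE !pact_pure !actM.
Qed.

Fact tmulA : associative tmul.
Proof. by move=> r s t; rewrite [RHS]pactM. Qed.
Fact tmul1r : left_id (pure 1 1) tmul.
Proof. by move=> t; exact: (@pact1 A A' (regular A) (regular A')). Qed.
Fact tmulr1 : right_id (pure 1 1) tmul.
Proof.
elim/tensor_ind => [a b|k s t IHs IHt]; first by rewrite tmulE !mulr1.
by rewrite /tmul pactPl; congr (_ *: _ + _).
Qed.
Fact tmulDl : left_distributive tmul +%R.
Proof. by move=> r s t; have := @pactPl A A' (regular A) (regular A') 1 r s t; rewrite !scale1r. Qed.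
Fact tmulDr : right_distributive tmul +%R.
Proof. by move=> r s t; have := @pactPr A A' (regular A) (regular A') 1 r s t; rewrite !scale1r. Qed.

(* Only a possibly trivial ring: nontriviality is not needed. *)
HB.instance Definition _ := GRing.Zmodule_isPzRing.Build (tensor A A')
  tmulA tmul1r tmulr1 tmulDl tmulDr.
End TensorRing.
End Modules.

Record bialgebra (K : fieldType) (B : algType K) := Bialgebra {
  comul : {linear B -> tensor B B};
  counit : {lrmorphism B -> K^o};
  comul_monoid : monoid_morphism comul;
  comulA : forall b,
    tassoc B B B (tmap comul idfun (comul b)) = tmap idfun comul (comul b);
  comul_counitl : forall b, tlunit B (tmap counit idfun (comul b)) = b;
  comul_counitr : forall b, trunit B (tmap idfun counit (comul b)) = b
}.

Definition bialgebra_map (K : fieldType) (B H : algType K) (bB : bialgebra B)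
    (bH : bialgebra H) (f : {lrmorphism B -> H}) : Prop :=
  (forall b, comul bH (f b) = tmap f f (comul bB b)) /\
  (forall b, counit bH (f b) = counit bB b).

Record category := Category {
  obj :> Type;
  hom : obj -> obj -> Type;
  idc : forall X, hom X X;
  compc : forall X Y Z, hom Y Z -> hom X Y -> hom X Z;
  comp1c : forall X Y (f : hom X Y), compc (idc Y) f = f;
  compc1 : forall X Y (f : hom X Y), compc f (idc X) = f;
  compA : forall W X Y Z (h : hom Y Z) (g : hom X Y) (f : hom W X),
    compc h (compc g f) = compc (compc h g) f
}.
Arguments idc {c} X.

Reserved Notation "g \c f" (at level 50, left associativity).
Notation "g \c f" := (compc g f).

Definition is_iso (C : category) (X Y : C) (f : hom X Y) : Prop :=
  exists g : hom Y X, g \c f = idc X /\ f \c g = idc Y.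

Record functor (C D : category) := Functor {
  fobj :> C -> D;
  fmap : forall X Y, hom X Y -> hom (fobj X) (fobj Y);
  fmap1 : forall X, fmap (idc X) = idc (fobj X);
  fmapM : forall X Y Z (g : hom Y Z) (f : hom X Y),
    fmap (g \c f) = fmap g \c fmap f
}.

Record monoidal := Monoidal {
  mcat :> category;
  tens : mcat -> mcat -> mcat;
  tensm : forall X X' Y Y',
    hom X X' -> hom Y Y' -> hom (tens X Y) (tens X' Y');
  munit : mcat;
  massoc : forall X Y Z, hom (tens (tens X Y) Z) (tens X (tens Y Z));
  mlunit : forall X, hom (tens munit X) X;
  mrunit : forall X, hom (tens X munit) X;
  tensm1 : forall X Y, tensm (idc X) (idc Y) = idc (tens X Y);
  tensmM : forall X X' X'' Y Y' Y'' (f' : hom X' X'') (f : hom X X')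
    (g' : hom Y' Y'') (g : hom Y Y'),
    tensm (f' \c f) (g' \c g) = tensm f' g' \c tensm f g;
  massoc_iso : forall X Y Z, is_iso (massoc X Y Z);
  mlunit_iso : forall X, is_iso (mlunit X);
  mrunit_iso : forall X, is_iso (mrunit X);
  massoc_natural : forall X X' Y Y' Z Z'
    (f : hom X X') (g : hom Y Y') (h : hom Z Z'),
    massoc X' Y' Z' \c tensm (tensm f g) h =
    tensm f (tensm g h) \c massoc X Y Z;
  mlunit_natural : forall X X' (f : hom X X'),
    mlunit X' \c tensm (idc munit) f = f \c mlunit X;
  mrunit_natural : forall X X' (f : hom X X'),
    mrunit X' \c tensm f (idc munit) = f \c mrunit X;
  pentagon : forall W X Y Z,
    massoc W X (tens Y Z) \c massoc (tens W X) Y Z =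
    tensm (idc W) (massoc X Y Z) \c massoc W (tens X Y) Z
      \c tensm (massoc W X Y) (idc Z);
  triangle : forall X Y,
    tensm (idc X) (mlunit Y) \c massoc X munit Y = tensm (mrunit X) (idc Y)
}.
Arguments munit {m}.

Record bimonad_data (C : monoidal) := BimonadData {
  bm_fun :> functor C C;
  bm_mul : forall X, hom (bm_fun (bm_fun X)) (bm_fun X);
  bm_unit : forall X, hom X (bm_fun X);
  bm_comul : forall X Y, hom (bm_fun (tens X Y)) (tens (bm_fun X) (bm_fun Y));
  bm_counit : hom (bm_fun munit) munit
}.

Section Bimonad.
Variables (C : monoidal) (T : bimonad_data C).
Let mu := bm_mul T.
Let eta := bm_unit T.
Let T2 := bm_comul T.
Let T0 := bm_counit T.

Definition is_monad : Prop :=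
  [/\ forall (X Y : C) (f : hom X Y),
        mu Y \c fmap T (fmap T f) = fmap T f \c mu X,
      forall (X Y : C) (f : hom X Y), eta Y \c f = fmap T f \c eta X,
      forall X : C, mu X \c fmap T (mu X) = mu X \c mu (T X)
    & forall X : C, mu X \c eta (T X) = idc (T X) /\
        mu X \c fmap T (eta X) = idc (T X)].

Definition is_opmonoidal_functor : Prop :=
  [/\ forall (X X' Y Y' : C) (f : hom X X') (g : hom Y Y'),
        T2 X' Y' \c fmap T (tensm f g) =
        tensm (fmap T f) (fmap T g) \c T2 X Y,
      forall X Y Z : C,
        massoc (T X) (T Y) (T Z) \c tensm (T2 X Y) (idc (T Z)) \c
          T2 (tens X Y) Z =
        tensm (idc (T X)) (T2 Y Z) \c T2 X (tens Y Z) \c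
          fmap T (massoc X Y Z),
      forall X : C,
        mlunit (T X) \c tensm T0 (idc (T X)) \c T2 munit X =
        fmap T (mlunit X)
    & forall X : C,
        mrunit (T X) \c tensm (idc (T X)) T0 \c T2 X munit =
        fmap T (mrunit X)].

Definition mul_opmonoidal : Prop :=
  (forall X Y : C,
     T2 X Y \c mu (tens X Y) =
     tensm (mu X) (mu Y) \c T2 (T X) (T Y) \c fmap T (T2 X Y)) /\
  T0 \c mu munit = T0 \c fmap T T0.

Definition unit_opmonoidal : Prop :=
  (forall X Y : C, T2 X Y \c eta (tens X Y) = tensm (eta X) (eta Y)) /\
  T0 \c eta munit = idc munit.

Definition is_bimonad : Prop :=
  [/\ is_monad, is_opmonoidal_functor, mul_opmonoidal & unit_opmonoidal].

Definition left_fusion (X Y : C) : hom (T (tens X (T Y))) (tens (T X) (T Y)) :=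
  tensm (idc (T X)) (mu Y) \c T2 X (T Y).

Definition is_left_hopf_monad : Prop :=
  is_bimonad /\ forall X Y : C, is_iso (left_fusion X Y).
End Bimonad.

Record amod_hom (K : fieldType) (A : algType K) (M N : amod A) := AModHom {
  amod_fun :> {linear M -> N};
  amod_funJ : forall a m, amod_fun (act a m) = act a (amod_fun m)
}.

Lemma amod_hom_ext (K : fieldType) (A : algType K) (M N : amod A)
  (f g : amod_hom M N) : (forall m, f m = g m) -> f = g.
Proof.
move=> fg; case: f g fg => [f fJ] [g gJ] /= fg.
have E := linear_ext fg; move: gJ; rewrite -E => gJ.
by rewrite (Prop_irrelevance fJ gJ).
Qed.

Section ModuleCategory.
Variables (K : fieldType) (A : algType K).

Definition amod_id (M : amod A) : amod_hom M M :=
  @AModHom K A M M idfun (fun _ _ => erefl).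
Fact amod_comp_subproof (M N P : amod A) (g : amod_hom N P) (f : amod_hom M N)
  a m : (g \o f) (act a m) = act a ((g \o f) m).
Proof. by rewrite /= !amod_funJ. Qed.
Definition amod_comp (M N P : amod A) (g : amod_hom N P) (f : amod_hom M N) :
  amod_hom M P := @AModHom K A M P (g \o f) (amod_comp_subproof g f).

Definition amod_cat : category.
Proof.
by refine (@Category (amod A) (@amod_hom K A) amod_id amod_comp _ _ _) => *;
  exact: amod_hom_ext.
Defined.
End ModuleCategory.

Section BialgebraModules.
Variables (K : fieldType) (B : algType K) (bB : bialgebra B).
Implicit Types X Y Z : amod B.

Section TensorModule.
Variables X Y : amod B.

(* b (x (x) y) = b_(1) x (x) b_(2) y *)
Definition tmod_act (b : B) (t : tensor X Y) : tensor X Y :=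
  pact (comul bB b) t.
Fact tmod_bilinear : bilin tmod_act.
Proof.
split=> [t a b b'|b a t t'] /=; rewrite /tmod_act; last exact: pactPr.
by rewrite linearP pactPl.
Qed.
Fact tmod_act1 t : tmod_act 1 t = t.
Proof. by rewrite /tmod_act (comul_monoid bB).1 pact1. Qed.
Fact tmod_actM a b t : tmod_act (a * b) t = tmod_act a (tmod_act b t).
Proof. by rewrite /tmod_act (comul_monoid bB).2 -pactM. Qed.

Definition tmod : amod B := AMod tmod_bilinear tmod_act1 tmod_actM.

Lemma tmodE b (t : tmod) : act b t = pact (comul bB b) t.
Proof. by []. Qed.
End TensorModule.

Fact umod_bilinear : bilin (fun (b : B) (k : K^o) => (counit bB b * k : K^o)).
Proof.
split=> [k a b b'|b a k k'] /=; first by rewrite linearP mulrDl scalerAl.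
by rewrite mulrDr scalerAr.
Qed.
Definition umod : amod B.
Proof.
apply: (AMod umod_bilinear) => [k|a b k]; first by rewrite rmorph1 mul1r.
by rewrite rmorphM mulrA.
Defined.

Fact tmodm_subproof X X' Y Y' (f : amod_hom X X') (g : amod_hom Y Y') b
    (t : tmod X Y) : tmap f g (act b t) = act b (tmap f g t : tmod X' Y').
Proof.
rewrite !tmodE; elim/tensor_ind: (comul bB b) => [a a'|k s s' IH IH']; last first.
  by rewrite !pactPl linearP IH IH'.
elim/tensor_ind: t => [x y|k t t' IH IH'].
  by rewrite pact_pure !tmapE pact_pure !amod_funJ.
by rewrite pactPr !linearP IH IH' pactPr.
Qed.
Definition tmodm X X' Y Y' (f : amod_hom X X') (g : amod_hom Y Y') :
  amod_hom (tmod X Y) (tmod X' Y') := @AModHom K B (tmod X Y) (tmod X' Y') (tmap f g) (tmodm_subproof f g).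

Section AssocAct.
Variables X Y Z : amod B.

(* a (x) s acts on X (x) (Y (x) Z) as a (x) (s acting on Y (x) Z). *)
Let act3 x (u : tensor Y Z) : tensor B (tensor B B) -> tensor X (tensor Y Z) :=
  tlift (fun a s => pure (act a x : X) (pact s u)).
Let act3_bilinear x u :
  bilin (fun (a : B) (s : tensor B B) => pure (act a x : X) (pact s (u : tensor Y Z))).
Proof. by split=> [s k a a'|a k s s']; cbv beta; rewrite (actPl, pactPl) (purePl, purePr). Qed.

Fact massoc_subproof b (t : tmod (tmod X Y) Z) :
  tassoc X Y Z (act b t) = act b (tassoc X Y Z t : tmod X (tmod Y Z)).
Proof.
elim/tensor_ind: t => [t z|k t t' IH IH']; last by rewrite actPr !linearP IH IH' actPr.
elim/tensor_ind: t => [x y|k t t' IH IH']; last by rewrite purePl actPr !linearP IH IH' actPr.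
rewrite tassocE !tmodE.
pose L := mklinear (tlift_linear (act3_bilinear x (pure y z))).
have -> : pact (comul bB b) (pure x (pure y z : tmod Y Z)) = L (tmap idfun (comul bB) (comul bB b)).
  elim/tensor_ind: (comul bB b) => [a a'|k s s' IH IH']; last by rewrite pactPl !linearP IH IH'.
  by rewrite pact_pure tmapE -[RHS]/(tlift _ _) (tliftE (act3_bilinear _ _)).
rewrite -comulA; elim/tensor_ind: (comul bB b) => [a a'|k s s' IH IH'].
  rewrite pact_pure tmapE tmodE.
  elim/tensor_ind: (comul bB a) => [c c'|k s s' IH IH'].
    by rewrite pact_pure !tassocE -[RHS]/(tlift _ _) (tliftE (act3_bilinear _ _)) pact_pure.
  by rewrite pactPl !purePl !linearP IH IH'.
by rewrite pactPl !linearP IH IH'.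
Qed.
Definition amassoc : amod_hom (tmod (tmod X Y) Z) (tmod X (tmod Y Z)) :=
  @AModHom K B (tmod (tmod X Y) Z) (tmod X (tmod Y Z)) (tassoc X Y Z) massoc_subproof.
End AssocAct.

Fact mlunit_subproof X b (t : tmod umod X) :
  tlunit X (act b t) = act b (tlunit X t).
Proof.
elim/tensor_ind: t => [c x|c t t' IH IH']; last by rewrite actPr !linearP IH IH' actPr.
rewrite tlunitE tmodE -[in RHS](comul_counitl bB b).
elim/tensor_ind: (comul bB b) => [a a'|k s s' IH IH']; last first.
  by rewrite pactPl !linearP IH IH' actPl.
by rewrite pact_pure tmapE !tlunitE actZl actZr scalerA.
Qed.
Definition amlunit X : amod_hom (tmod umod X) X := @AModHom K B (tmod umod X) X (tlunit X) (@mlunit_subproof X).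

Fact mrunit_subproof X b (t : tmod X umod) :
  trunit X (act b t) = act b (trunit X t).
Proof.
elim/tensor_ind: t => [x c|c t t' IH IH']; last by rewrite actPr !linearP IH IH' actPr.
rewrite trunitE tmodE -[in RHS](comul_counitr bB b).
elim/tensor_ind: (comul bB b) => [a a'|k s s' IH IH']; last first.
  by rewrite pactPl !linearP IH IH' actPl.
by rewrite pact_pure tmapE !trunitE actZl actZr scalerA.
Qed.
Definition amrunit X : amod_hom (tmod X umod) X := @AModHom K B (tmod X umod) X (trunit X) (@mrunit_subproof X).

Fact iso_intro X Y (f : amod_hom X Y) (g : {linear Y -> X}) :
  cancel f g -> cancel g f -> @is_iso (amod_cat B) X Y f.
Proof.
move=> fK gK.
have gJ a m : g (act a m) = act a (g m) by apply: (can_inj fK); rewrite gK amod_funJ gK.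
by exists (AModHom gJ); split; apply: amod_hom_ext.
Qed.

Lemma amod_compE X Y Z (g : amod_hom Y Z) (f : amod_hom X Y) x :
  amod_fun (@compc (amod_cat B) X Y Z g f) x = g (f x).
Proof. by []. Qed.
Lemma tmodmE X X' Y Y' (f : amod_hom X X') (g : amod_hom Y Y') x y :
  tmodm f g (pure x y) = pure (f x) (g y).
Proof. exact: tmapE. Qed.
Lemma amassocE X Y Z (x : X) (y : Y) (z : Z) :
  amassoc X Y Z (pure (pure x y : tmod X Y) z) = pure x (pure y z : tmod Y Z).
Proof. exact: tassocE. Qed.
Lemma amlunitE X (k : umod) (x : X) : amlunit X (pure k x) = (k : K) *: x.
Proof. exact: tlunitE. Qed.
Lemma amrunitE X (k : umod) (x : X) : amrunit X (pure x k) = (k : K) *: x.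
Proof. exact: trunitE. Qed.
Let amodE := (amod_compE, tmodmE, amassocE, amlunitE, amrunitE).

Definition amod_monoidal : monoidal.
Proof.
refine (@Monoidal (amod_cat B) tmod tmodm umod amassoc amlunit amrunit
  _ _ _ _ _ _ _ _ _ _).
- move=> X Y; apply: amod_hom_ext; elim/tensor_ind => [x y|k s t IHs IHt].
    exact: tmapE.
  by rewrite !linearP IHs IHt.
- move=> X X' X'' Y Y' Y'' f' f g' g; apply: amod_hom_ext.
  elim/tensor_ind => [x y|k s t IHs IHt]; last by rewrite !linearP IHs IHt.
  by rewrite !amodE.
- by move=> X Y Z; apply: iso_intro; [exact: tassocK|exact: tassocVK].
- by move=> X; apply: iso_intro; [exact: tlunitK|exact: tlunitVK].
- by move=> X; apply: iso_intro; [exact: trunitK|exact: trunitVK].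
- move=> X X' Y Y' Z Z' f g h; apply: amod_hom_ext.
  elim/tensor_ind => [s z|k s t IHs IHt]; last by rewrite !linearP IHs IHt.
  elim/tensor_ind: s => [x y|k s t IHs IHt]; last by rewrite purePl !linearP IHs IHt.
  by rewrite !amodE.
- move=> X X' f; apply: amod_hom_ext.
  elim/tensor_ind => [k x|k s t IHs IHt]; last by rewrite !linearP IHs IHt.
  by rewrite !amodE linearZ_LR.
- move=> X X' f; apply: amod_hom_ext.
  elim/tensor_ind => [x k|k s t IHs IHt]; last by rewrite !linearP IHs IHt.
  by rewrite !amodE linearZ_LR.
- move=> W X Y Z; apply: amod_hom_ext.
  elim/tensor_ind => [s z|k s t IHs IHt]; last by rewrite !linearP IHs IHt.
  elim/tensor_ind: s => [s y|k s t IHs IHt]; last by rewrite purePl !linearP IHs IHt.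
  elim/tensor_ind: s => [w x|k s t IHs IHt]; last by rewrite !purePl !linearP IHs IHt.
  by rewrite !amodE.
- move=> X Y; apply: amod_hom_ext.
  elim/tensor_ind => [s y|k s t IHs IHt]; last by rewrite !linearP IHs IHt.
  elim/tensor_ind: s => [x k|k s t IHs IHt]; last by rewrite purePl !linearP IHs IHt.
  by rewrite !amodE pureZr -pureZl.
Defined.
End BialgebraModules.

Section ExtensionRestriction.
Variables (K : fieldType) (B H : algType K) (f : {lrmorphism B -> H}).

(* H (x)_B M, for the right B-action h . b = h * f b on H. *)
Section Ext.
Variable M : amod B.

Inductive balance_rel : tensor H M -> Prop :=
  BalanceRel h b m : balance_rel (pure (h * f b) m - pure h (act b m)).

Definition btensor : Type := quotmod balance_rel.
HB.instance Definition _ := GRing.Lmodule.on btensor.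

Definition bpure (h : H) (m : M) : btensor := qpi balance_rel (pure h m).

Lemma bpure_bilinear : bilin bpure.
Proof.
split=> [m k h h'|h k m m']; rewrite /bpure.
  by rewrite purePl linearP.
by rewrite purePr linearP.
Qed.
Lemma bpurePl k h h' m : bpure (k *: h + h') m = k *: bpure h m + bpure h' m.
Proof. exact: bpure_bilinear.1. Qed.
Lemma bpurePr k h m m' : bpure h (k *: m + m') = k *: bpure h m + bpure h m'.
Proof. exact: bpure_bilinear.2. Qed.
Lemma bpureZr k h m : bpure h (k *: m) = k *: bpure h m.
Proof. exact: (linearZ_LR (mklinear (bpure_bilinear.2 h))). Qed.

Lemma bpure_balanced h b m : bpure (h * f b) m = bpure h (act b m).
Proof. by apply/qpiP/lspan_gen. Qed.

Lemma btensor_ind (P : btensor -> Prop) :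
  (forall h m, P (bpure h m)) -> (forall k s t, P s -> P t -> P (k *: s + t)) ->
  forall t, P t.
Proof.
move=> Pp Pl; elim/qpi_surj; elim/tensor_ind => [h m|k s t IHs IHt]; first exact: Pp.
by rewrite linearP; apply: Pl.
Qed.

(* Map induced by [g]; meaningful only when [g] is bilinear and balanced. *)
Definition blift (W : lmodType K) (g : H -> M -> W) : btensor -> W :=
  @qlift _ _ balance_rel W (tlift g).

Section Lift.
Variables (W : lmodType K) (g : H -> M -> W).
Hypothesis gB : bilin g.
Hypothesis gb : forall h b m, g (h * f b) m = g h (act b m).

Let g0 t : balance_rel t -> tlift g t = 0.
Proof.
case=> h b m; rewrite -[LHS]/(mklinear (tlift_linear gB) _) linearB.
by rewrite [X in X - _](tliftE gB) [X in _ - X](tliftE gB) gb subrr.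
Qed.

Lemma blift_linear : linear (blift g).
Proof. exact: (qlift_linear (tlift_linear gB) g0). Qed.
Lemma bliftE h m : blift g (bpure h m) = g h m.
Proof. by rewrite /blift (qliftE (tlift_linear gB) g0) tliftE. Qed.
End Lift.

Section Action.
Variable h : H.
Fact ext_act_bilinear : bilin (fun h' m => bpure (h * h') m).
Proof.
split=> [m k a b|a k m m']; cbv beta; last by rewrite bpurePr.
by rewrite mulrDr -scalerAr bpurePl.
Qed.
Fact ext_act_balanced h' b m : bpure (h * (h' * f b)) m = bpure (h * h') (act b m).
Proof. by rewrite mulrA bpure_balanced. Qed.
End Action.

(* h (h' (x)_B m) = h h' (x)_B m *)
Definition ext_act (h : H) : btensor -> btensor :=
  blift (fun h' m => bpure (h * h') m).
Lemma ext_actE h h' m : ext_act h (bpure h' m) = bpure (h * h') m.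
Proof. exact: (bliftE (ext_act_bilinear h) (ext_act_balanced h)). Qed.
Lemma ext_actPr h : linear (ext_act h).
Proof. exact: (blift_linear (ext_act_bilinear h) (ext_act_balanced h)). Qed.
Fact ext_act_bilin : bilin ext_act.
Proof.
split=> [t k a b|h]; last exact: ext_actPr.
cbv beta; elim/btensor_ind: t => [h m|c s t IHs IHt].
  by rewrite !ext_actE mulrDl -scalerAl bpurePl.
by rewrite !ext_actPr IHs IHt comb_swap.
Qed.
Fact ext_act1 t : ext_act 1 t = t.
Proof.
elim/btensor_ind: t => [h m|c s t IHs IHt]; first by rewrite ext_actE mul1r.
by rewrite ext_actPr IHs IHt.
Qed.
Fact ext_actM a b t : ext_act (a * b) t = ext_act a (ext_act b t).
Proof.
elim/btensor_ind: t => [h m|c s t IHs IHt]; first by rewrite !ext_actE mulrA.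
by rewrite !ext_actPr IHs IHt.
Qed.

Definition ext_mod : amod H := AMod ext_act_bilin ext_act1 ext_actM.
End Ext.

Lemma ext_modE (M : amod B) (h h' : H) (m : M) :
  act h (bpure h' m : ext_mod M) = bpure (h * h') m.
Proof. exact: ext_actE. Qed.

Section Res.
Variable N : amod H.
Fact res_bilinear : bilin (fun b (n : N) => act (f b) n).
Proof. by split=> [n k a b|a k n n'] /=; rewrite ?linearP (actPl, actPr). Qed.
Fact res_act1 (n : N) : act (f 1) n = n.
Proof. by rewrite rmorph1 act1. Qed.
Fact res_actM a b (n : N) : act (f (a * b)) n = act (f a) (act (f b) n).
Proof. by rewrite rmorphM actM. Qed.
Definition res_mod : amod B := AMod res_bilinear res_act1 res_actM.
End Res.

Lemma res_modE (N : amod H) b (n : N) : act b (n : res_mod N) = act (f b) n.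
Proof. by []. Qed.

Section ExtMap.
Variables (M N : amod B) (g : amod_hom M N).
Fact ext_map_bilinear : bilin (fun h (m : M) => bpure h (g m)).
Proof. by split=> [m k a b|a k m m']; cbv beta; rewrite ?linearP (bpurePl, bpurePr). Qed.
Fact ext_map_balanced h b m : bpure (h * f b) (g m) = bpure h (g (act b m)).
Proof. by rewrite amod_funJ bpure_balanced. Qed.
Definition ext_lin : {linear ext_mod M -> ext_mod N} :=
  mklinear (blift_linear ext_map_bilinear ext_map_balanced).
Lemma ext_linE h m : ext_lin (bpure h m) = bpure h (g m).
Proof. exact: (bliftE ext_map_bilinear ext_map_balanced). Qed.
Fact ext_linJ h (t : ext_mod M) : ext_lin (act h t) = act h (ext_lin t).
Proof.
elim/btensor_ind: t => [h' m|k s t IHs IHt].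
  by rewrite ext_modE !ext_linE ext_modE.
by rewrite actPr !linearP IHs IHt actPr.
Qed.
Definition ext_map : amod_hom (ext_mod M) (ext_mod N) :=
  @AModHom K H (ext_mod M) (ext_mod N) ext_lin ext_linJ.
End ExtMap.

Definition res_map (M N : amod H) (g : amod_hom M N) :
    amod_hom (res_mod M) (res_mod N) :=
  @AModHom K B (res_mod M) (res_mod N) g (fun b => amod_funJ g (f b)).

Definition ext_functor : functor (amod_cat B) (amod_cat H).
Proof.
refine (@Functor (amod_cat B) (amod_cat H) ext_mod ext_map _ _).
- move=> M; apply: amod_hom_ext; elim/btensor_ind => [h m|k s t IHs IHt].
    exact: ext_linE.
  by rewrite !linearP IHs IHt.
- move=> M N P g' g; apply: amod_hom_ext.
  elim/btensor_ind => [h m|k s t IHs IHt]; last by rewrite !linearP IHs IHt.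
  rewrite amod_compE [LHS]ext_linE.
  by rewrite [in RHS](ext_linE g h m : ext_map g _ = _) [RHS]ext_linE.
Defined.

Definition res_functor : functor (amod_cat H) (amod_cat B).
Proof.
by refine (@Functor (amod_cat H) (amod_cat B) res_mod res_map _ _) => *;
  exact: amod_hom_ext.
Defined.

(* The counit H (x)_B N -> N, h (x)_B n |-> h n, of extension -| restriction. *)
Section Counit.
Variable N : amod H.
Fact ext_counit_bilinear : bilin (fun h (n : res_mod N) => @act K H N h n).
Proof. exact: act_bilinear. Qed.
Fact ext_counit_balanced h b (n : res_mod N) :
  @act K H N (h * f b) n = @act K H N h (act b n).
Proof. exact: actM. Qed.
Definition ext_counit_lin : {linear ext_mod (res_mod N) -> N} :=
  mklinear (blift_linear ext_counit_bilinear ext_counit_balanced).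
Lemma ext_counit_linE h (n : res_mod N) : ext_counit_lin (bpure h n) = @act K H N h n.
Proof. exact: (bliftE ext_counit_bilinear ext_counit_balanced). Qed.
Fact ext_counitJ h (t : ext_mod (res_mod N)) :
  ext_counit_lin (act h t) = act h (ext_counit_lin t).
Proof.
elim/btensor_ind: t => [h' m|k s t IHs IHt].
  by rewrite ext_modE !ext_counit_linE actM.
by rewrite actPr !linearP IHs IHt actPr.
Qed.
Definition ext_counit : amod_hom (ext_mod (res_mod N)) N :=
  @AModHom K H (ext_mod (res_mod N)) N ext_counit_lin ext_counitJ.
End Counit.

Section UnitMap.
Variable M : amod B.
Definition ext_unit_lin : {linear M -> res_mod (ext_mod M)} :=
  mklinear ((bpure_bilinear M).2 1).
Fact ext_unitJ b (m : M) : ext_unit_lin (act b m) = act b (ext_unit_lin m).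
Proof.
rewrite res_modE [ext_unit_lin m]/(bpure 1 m) ext_modE mulr1.
by rewrite -[f b]mul1r bpure_balanced.
Qed.
Definition ext_unit : amod_hom M (res_mod (ext_mod M)) := AModHom ext_unitJ.
End UnitMap.
End ExtensionRestriction.

Definition functor_comp (C D E : category) (G : functor D E) (F : functor C D) :
  functor C E.
Proof.
refine (@Functor C E (fun X => G (F X)) (fun X Y h => fmap G (fmap F h)) _ _).
- by move=> X; rewrite !fmap1.
- by move=> X Y Z g h; rewrite !fmapM.
Defined.

Section ExtBimonad.
Variables (K : fieldType) (B H : algType K).
Variables (bB : bialgebra B) (bH : bialgebra H) (f : {lrmorphism B -> H}).
Hypothesis fbi : bialgebra_map bB bH f.

Local Notation T M := (res_mod f (ext_mod f M)).

Section Comul.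
Variables X Y : amod B.
Local Notation "X \ox Y" := (tmod bB X Y) (at level 40).

Let bpl (x : X) : {linear H -> T X} := mklinear ((bpure_bilinear f X).1 x).
Let bpr (y : Y) : {linear H -> T Y} := mklinear ((bpure_bilinear f Y).1 y).

(* (x, y) |-> (h_(1) (x)_B x) (x) (h_(2) (x)_B y) *)
Definition ext_comul_fun (h : H) : X \ox Y -> T X \ox T Y :=
  tlift (fun x y => tmap (bpl x) (bpr y) (comul bH h)).

Let comul_bilin (s : tensor H H) : bilin (fun x y => tmap (bpl x) (bpr y) s).
Proof.
split=> [y k x x'|x k y y']; cbv beta;
  (elim/tensor_ind: s => [a a'|c s t IHs IHt];
    [rewrite !tmapE|by rewrite !linearP IHs IHt comb_swap]).
  by rewrite [bpl _ a]bpurePr purePl.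
by rewrite [bpr _ a']bpurePr purePr.
Qed.

Let ext_comul_funE h x y :
  ext_comul_fun h (pure x y) = tmap (bpl x) (bpr y) (comul bH h).
Proof. exact: (tliftE (comul_bilin _)). Qed.

Let ext_comul_bilinear : bilin ext_comul_fun.
Proof.
split=> [t k h h'|h]; last exact: (tlift_linear (comul_bilin _)).
cbv beta; elim/tensor_ind: t => [x y|c s t IHs IHt].
  by rewrite !ext_comul_funE !linearP.
have tL h0 := tlift_linear (comul_bilin (comul bH h0)).
by rewrite /ext_comul_fun !tL -!/(ext_comul_fun _ _) IHs IHt comb_swap.
Qed.

Let ext_comul_balanced h b (t : X \ox Y) :
  ext_comul_fun (h * f b) t = ext_comul_fun h (act b t).
Proof.
have L1 h0 := ext_comul_bilinear.2 h0.
elim/tensor_ind: t => [x y|c s t IHs IHt]; last by rewrite actPr !L1 IHs IHt.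
rewrite ext_comul_funE (comul_monoid bH).2 fbi.1 tmodE.
elim/tensor_ind: (comul bB b) => [a a'|c s t IHs IHt]; last first.
  rewrite pactPl L1 -IHs -IHt linearP.
  by rewrite [_ * (_ + _)](@pactPr _ _ _ (regular H) (regular H)) linearP.
rewrite pact_pure tmapE ext_comul_funE.
elim/tensor_ind: (comul bH h) => [d d'|c s t IHs IHt]; last first.
  by rewrite [(_ + _) * _](@pactPl _ _ _ (regular H) (regular H)) !linearP IHs IHt.
rewrite [_ * _]tmulE !tmapE; congr pure; exact: bpure_balanced.
Qed.

Definition ext_comul_lin : {linear T (X \ox Y) -> T X \ox T Y} :=
  mklinear (blift_linear ext_comul_bilinear ext_comul_balanced).

Lemma ext_comul_linE h x y : ext_comul_lin (bpure f h (pure x y : X \ox Y)) =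
  tmap (bpl x) (bpr y) (comul bH h).
Proof.
rewrite -ext_comul_funE; exact: (bliftE ext_comul_bilinear ext_comul_balanced).
Qed.

Fact ext_comulJ b (t : T (X \ox Y)) :
  ext_comul_lin (act b t) = act b (ext_comul_lin t).
Proof.
elim/btensor_ind: t => [h t|k s t IHs IHt]; last by rewrite actPr !linearP IHs IHt actPr.
elim/tensor_ind: t => [x y|k s t IHs IHt]; last first.
  by rewrite bpurePr actPr !linearP IHs IHt actPr.
rewrite res_modE ext_modE !ext_comul_linE tmodE (comul_monoid bH).2 fbi.1.
elim/tensor_ind: (comul bB b) => [a a'|c s t IHs IHt]; last first.
  rewrite pactPl -IHs -IHt linearP.
  by rewrite [(_ + _) * _](@pactPl _ _ _ (regular H) (regular H)) linearP.
elim/tensor_ind: (comul bH h) => [d d'|c s t IHs IHt]; last first.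
  by rewrite [_ * (_ + _)](@pactPr _ _ _ (regular H) (regular H)) !linearP IHs IHt pactPr.
rewrite !tmapE [_ * _]tmulE tmapE pact_pure.
by congr pure; exact: (esym (ext_modE _ _ _ _)).
Qed.

Definition ext_comul : amod_hom (T (X \ox Y)) (T X \ox T Y) :=
  @AModHom K B (T (X \ox Y)) (T X \ox T Y) ext_comul_lin ext_comulJ.
End Comul.

(* h (x)_B k |-> eps_H(h) k *)
Let ext_eps_bilinear : bilin (fun (h : H) (k : umod bB) => (counit bH h * k : K^o)).
Proof. exact: (umod_bilinear bH). Qed.
Let ext_eps_balanced h b (k : umod bB) :
  (counit bH (h * f b) * k : K^o) = counit bH h * (act b k : K^o).
Proof. by rewrite rmorphM /= fbi.2 mulrA. Qed.
Definition ext_eps_lin : {linear T (umod bB) -> umod bB} :=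
  mklinear (blift_linear ext_eps_bilinear ext_eps_balanced).
Lemma ext_eps_linE h (k : umod bB) : ext_eps_lin (bpure f h k) = counit bH h * k :> K^o.
Proof. exact: (bliftE ext_eps_bilinear ext_eps_balanced). Qed.
Fact ext_epsJ b (t : T (umod bB)) : ext_eps_lin (act b t) = act b (ext_eps_lin t).
Proof.
elim/btensor_ind: t => [h k|k s t IHs IHt]; last by rewrite actPr !linearP IHs IHt actPr.
rewrite res_modE ext_modE !ext_eps_linE rmorphM /= fbi.2 -mulrA.
by rewrite -[RHS]/(counit bB b * _) .
Qed.
Definition ext_eps : amod_hom (T (umod bB)) (umod bB) :=
  @AModHom K B (T (umod bB)) (umod bB) ext_eps_lin ext_epsJ.

Definition ext_bimonad : bimonad_data (amod_monoidal bB) :=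
  @BimonadData (amod_monoidal bB)
    (functor_comp (res_functor f) (ext_functor f))
    (fun M => res_map f (ext_counit f (ext_mod f M)))
    (fun M => ext_unit f M) ext_comul ext_eps.
End ExtBimonad.

(* B<x>: terms in the elements of B and x, modulo the congruence making the
   terms a K-algebra over B.  Scaling by k is multiplication by k%:A. *)
Section FreeAlgebra.
Variables (K : fieldType) (B : algType K).

Inductive fx_term :=
| fx_base of B
| fx_var
| fx_add of fx_term & fx_term
| fx_mul of fx_term & fx_term.

HB.instance Definition _ := gen_eqMixin fx_term.
HB.instance Definition _ := gen_choiceMixin fx_term.

Inductive fx_eq : fx_term -> fx_term -> Prop :=
| fx_refl t : fx_eq t t
| fx_sym s t : fx_eq s t -> fx_eq t s
| fx_trans s t u : fx_eq s t -> fx_eq t u -> fx_eq s u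
| fx_add_congr s s' t t' :
    fx_eq s s' -> fx_eq t t' -> fx_eq (fx_add s t) (fx_add s' t')
| fx_mul_congr s s' t t' :
    fx_eq s s' -> fx_eq t t' -> fx_eq (fx_mul s t) (fx_mul s' t')
| fx_baseD a b : fx_eq (fx_base (a + b)) (fx_add (fx_base a) (fx_base b))
| fx_baseM a b : fx_eq (fx_base (a * b)) (fx_mul (fx_base a) (fx_base b))
| fx_addA s t u : fx_eq (fx_add s (fx_add t u)) (fx_add (fx_add s t) u)
| fx_addC s t : fx_eq (fx_add s t) (fx_add t s)
| fx_add0 t : fx_eq (fx_add (fx_base 0) t) t
| fx_addN t : fx_eq (fx_add (fx_mul (fx_base (- 1)) t) t) (fx_base 0)
| fx_mulA s t u : fx_eq (fx_mul s (fx_mul t u)) (fx_mul (fx_mul s t) u)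
| fx_mul1 t : fx_eq (fx_mul (fx_base 1) t) t
| fx_mulr1 t : fx_eq (fx_mul t (fx_base 1)) t
| fx_mulDl s t u :
    fx_eq (fx_mul (fx_add s t) u) (fx_add (fx_mul s u) (fx_mul t u))
| fx_mulDr s t u :
    fx_eq (fx_mul s (fx_add t u)) (fx_add (fx_mul s t) (fx_mul s u))
| fx_scaleC (k : K) t :
    fx_eq (fx_mul (fx_base k%:A) t) (fx_mul t (fx_base k%:A)).

Definition fx_eqb (s t : fx_term) : bool := `[< fx_eq s t >].
Lemma fx_eqb_refl : reflexive fx_eqb.
Proof. by move=> t; apply/asboolP; exact: fx_refl. Qed.
Lemma fx_eqb_sym : symmetric fx_eqb.
Proof. by move=> s t; apply/asboolP/asboolP; exact: fx_sym. Qed.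
Lemma fx_eqb_trans : transitive fx_eqb.
Proof. by move=> t s u /asboolP st /asboolP tu; apply/asboolP; exact: fx_trans tu. Qed.
Canonical fx_equiv := EquivRel fx_eqb fx_eqb_refl fx_eqb_sym fx_eqb_trans.

Definition freealg := {eq_quot fx_eqb}.
HB.instance Definition _ := Choice.on freealg.
HB.instance Definition _ := EqQuotient.on freealg.

Let fpi (t : fx_term) : freealg := \pi_freealg t.

Let fpiP s t : fpi s = fpi t <-> fx_eq s t.
Proof.
split=> [/eqP|st]; first by rewrite /fpi (eqmodE fx_equiv) => /asboolP.
by apply/eqP; rewrite /fpi (eqmodE fx_equiv); apply/asboolP.
Qed.
Let fpi_surj (P : freealg -> Prop) : (forall t, P (fpi t)) -> forall x, P x.
Proof. by move=> H x; rewrite -[x]reprK; exact: H. Qed.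
Let repr_fpi t : fx_eq (repr (fpi t)) t.
Proof. by apply/fpiP; rewrite /fpi reprK. Qed.

Let fadd (x y : freealg) := fpi (fx_add (repr x) (repr y)).
Let fmul (x y : freealg) := fpi (fx_mul (repr x) (repr y)).
Let fopp (x : freealg) := fmul (fpi (fx_base (- 1))) x.
Let fscale (k : K) (x : freealg) := fmul (fpi (fx_base k%:A)) x.

Let fpiD s t : fadd (fpi s) (fpi t) = fpi (fx_add s t).
Proof. by apply/fpiP/fx_add_congr; exact: repr_fpi. Qed.
Let fpiM s t : fmul (fpi s) (fpi t) = fpi (fx_mul s t).
Proof. by apply/fpiP/fx_mul_congr; exact: repr_fpi. Qed.
Let fpi_base a b : fmul (fpi (fx_base a)) (fpi (fx_base b)) = fpi (fx_base (a * b)).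
Proof. by rewrite fpiM; apply/fpiP/fx_sym/fx_baseM. Qed.
Let fpi_baseD a b : fadd (fpi (fx_base a)) (fpi (fx_base b)) = fpi (fx_base (a + b)).
Proof. by rewrite fpiD; apply/fpiP/fx_sym/fx_baseD. Qed.

Fact faddA : associative fadd.
Proof. by do 3![elim/fpi_surj => ?]; rewrite !fpiD; apply/fpiP/fx_addA. Qed.
Fact faddC : commutative fadd.
Proof. by do 2![elim/fpi_surj => ?]; rewrite !fpiD; apply/fpiP/fx_addC. Qed.
Fact fadd0 : left_id (fpi (fx_base 0)) fadd.
Proof. by elim/fpi_surj => ?; rewrite fpiD; apply/fpiP/fx_add0. Qed.
Fact faddN : left_inverse (fpi (fx_base 0)) fopp fadd.
Proof. by elim/fpi_surj => ?; rewrite /fopp fpiM fpiD; apply/fpiP/fx_addN. Qed.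
HB.instance Definition _ := GRing.isZmodule.Build freealg faddA faddC fadd0 faddN.

Fact fmulA : associative fmul.
Proof. by do 3![elim/fpi_surj => ?]; rewrite !fpiM; apply/fpiP/fx_mulA. Qed.
Fact fmul1r : left_id (fpi (fx_base 1)) fmul.
Proof. by elim/fpi_surj => ?; rewrite fpiM; apply/fpiP/fx_mul1. Qed.
Fact fmulr1 : right_id (fpi (fx_base 1)) fmul.
Proof. by elim/fpi_surj => ?; rewrite fpiM; apply/fpiP/fx_mulr1. Qed.
Fact fmulDl : left_distributive fmul fadd.
Proof. by do 3![elim/fpi_surj => ?]; rewrite !(fpiM, fpiD); apply/fpiP/fx_mulDl. Qed.
Fact fmulDr : right_distributive fmul fadd.
Proof. by do 3![elim/fpi_surj => ?]; rewrite !(fpiM, fpiD); apply/fpiP/fx_mulDr. Qed.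

Fixpoint fx_eval (A : algType K) (g : B -> A) (a : A) (t : fx_term) : A :=
  match t with
  | fx_base b => g b
  | fx_var => a
  | fx_add s t => fx_eval g a s + fx_eval g a t
  | fx_mul s t => fx_eval g a s * fx_eval g a t
  end.

Lemma fx_eval_eq (A : algType K) (g : {lrmorphism B -> A}) (a : A) s t :
  fx_eq s t -> fx_eval g a s = fx_eval g a t.
Proof.
elim=> //=.
- by move=> {}s {}t u _ -> _ ->.
- by move=> {}s s' {}t t' _ -> _ ->.
- by move=> {}s s' {}t t' _ -> _ ->.
- by move=> *; rewrite linearD.
- by move=> *; rewrite rmorphM.
- by move=> *; rewrite addrA.
- by move=> *; rewrite addrC.
- by move=> *; rewrite linear0 add0r.
- by move=> *; rewrite linear0 linearN rmorph1 mulN1r addNr.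
- by move=> *; rewrite mulrA.
- by move=> *; rewrite rmorph1 mul1r.
- by move=> *; rewrite rmorph1 mulr1.
- by move=> *; rewrite mulrDl.
- by move=> *; rewrite mulrDr.
- by move=> k t0; rewrite linearZ_LR rmorph1 -scalerAl -scalerAr mul1r mulr1.
Qed.

Fact fone_neq0 : fpi (fx_base 1) != fpi (fx_base 0).
Proof.
by apply/eqP => /fpiP/(fx_eval_eq idfun 0)/eqP; rewrite /= oner_eq0.
Qed.
HB.instance Definition _ := GRing.Zmodule_isNzRing.Build freealg
  fmulA fmul1r fmulr1 fmulDl fmulDr fone_neq0.

Fact fscaleA a b x : fscale a (fscale b x) = fscale (a * b) x.
Proof. by rewrite /fscale fmulA fpi_base -scalerAl mul1r scalerA. Qed.
Fact fscale1 : left_id 1 fscale.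
Proof. by move=> x; rewrite /fscale scale1r fmul1r. Qed.
Fact fscaleDr : right_distributive fscale +%R.
Proof. by move=> a x y; rewrite /fscale [LHS]fmulDr. Qed.
Fact fscaleDl x : {morph fscale^~ x : a b / a + b}.
Proof. by move=> a b; rewrite /fscale scalerDl -fpi_baseD [LHS]fmulDl. Qed.
HB.instance Definition _ := GRing.Zmodule_isLmodule.Build K freealg
  fscaleA fscale1 fscaleDr fscaleDl.

Fact fscaleAl a (x y : freealg) : a *: (x * y) = (a *: x) * y.
Proof. exact: fmulA. Qed.
HB.instance Definition _ := GRing.Lmodule_isLalgebra.Build K freealg fscaleAl.
Fact fscaleAr a (x y : freealg) : a *: (x * y) = x * (a *: y).
Proof.
rewrite -[LHS]/(fmul _ (fmul x y)) -[RHS]/(fmul x (fmul _ y)) !fmulA; congr fmul.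
by elim/fpi_surj: x => t; rewrite !fpiM; apply/fpiP/fx_scaleC.
Qed.
HB.instance Definition _ := GRing.Lalgebra_isAlgebra.Build K freealg fscaleAr.

Definition free_base (b : B) : freealg := \pi_freealg (fx_base b).
Definition free_var : freealg := \pi_freealg fx_var.

Fact free_base_linear : linear free_base.
Proof.
move=> k a b; rewrite -[LHS]/(fpi _) -fpi_baseD; congr fadd.
by rewrite -[a in LHS]mul1r scalerAl -fpi_base.
Qed.
HB.instance Definition _ :=
  GRing.isLinear.Build K B freealg *:%R free_base free_base_linear.
Fact free_base_monoid : monoid_morphism free_base.
Proof. by split=> // a b; rewrite -[LHS]/(fpi _) -fpi_base. Qed.
HB.instance Definition _ :=
  GRing.isMonoidMorphism.Build B freealg free_base free_base_monoid.

Lemma free_ind (P : freealg -> Prop) :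
  (forall b, P (free_base b)) -> P free_var ->
  (forall x y, P x -> P y -> P (x + y)) -> (forall x y, P x -> P y -> P (x * y)) ->
  forall x, P x.
Proof.
move=> Pb Px PD PM; elim/fpi_surj; elim=> // s Ps t Pt.
  by rewrite -fpiD; exact: PD.
by rewrite -fpiM; exact: PM.
Qed.

(* Universal property of B<x>. *)
Lemma free_univ (A : algType K) (g : {lrmorphism B -> A}) (a : A) :
  exists phi : {lrmorphism freealg -> A},
    [/\ forall b, phi (free_base b) = g b, phi free_var = a
      & forall psi : {lrmorphism freealg -> A},
          (forall b, psi (free_base b) = g b) -> psi free_var = a -> psi =1 phi].
Proof.
pose phi (x : freealg) : A := fx_eval g a (repr x).
have phiE t : phi (fpi t) = fx_eval g a t by apply: fx_eval_eq; exact: repr_fpi.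
have phiM : monoid_morphism phi.
  split=> [|x y]; first by rewrite -[1]/(fpi _) phiE /= rmorph1.
  elim/fpi_surj: x => s; elim/fpi_surj: y => t.
  by rewrite -[_ * _]/(fmul _ _) fpiM !phiE.
have phiD x y : phi (x + y) = phi x + phi y.
  elim/fpi_surj: x => s; elim/fpi_surj: y => t.
  by rewrite -[fpi s + _]/(fadd _ _) fpiD !phiE.
have phiL : linear phi.
  move=> k x y; rewrite phiD; congr (_ + _).
  rewrite -[k *: x]/(fpi (fx_base k%:A) * x) phiM.2 phiE /=.
  by rewrite linearZ_LR rmorph1 -scalerAl mul1r.
pose Phi : {lrmorphism freealg -> A} :=
  HB.pack phi (GRing.isLinear.Build K freealg A *:%R phi phiL)
    (GRing.isMonoidMorphism.Build freealg A phi phiM).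
exists Phi; split=> [b||psi psib psix].
- exact: phiE.
- exact: phiE.
elim/free_ind => [b||x y IHx IHy|x y IHx IHy].
- by rewrite psib -[RHS]/(phi _) phiE.
- by rewrite psix -[RHS]/(phi _) phiE.
- by rewrite !linearD /= IHx IHy.
- by rewrite !rmorphM /= IHx IHy.
Qed.
End FreeAlgebra.

(* Quotient of an algebra by the two-sided ideal generated by [S], which is the
   lspan of the products a s b.  It may be trivial, so it is only a [pzRing]. *)
Section QuotientAlgebra.
Variables (K : fieldType) (A : algType K) (S : A -> Prop).

Inductive ideal_gen : A -> Prop :=
  IdealGen a s b : S s -> ideal_gen (a * s * b).

Definition quotalg : Type := quotmod ideal_gen.
HB.instance Definition _ := GRing.Lmodule.on quotalg.

Lemma ideal_mull a u : lspan ideal_gen u -> lspan ideal_gen (a * u).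
Proof.
elim=> [|k v w [c s b Ss] _ IH]; first by rewrite mulr0; exact: lspan0.
rewrite mulrDr -scalerAr !mulrA; apply: lspan_lin IH.
exact: IdealGen.
Qed.
Lemma ideal_mulr a u : lspan ideal_gen u -> lspan ideal_gen (u * a).
Proof.
elim=> [|k v w [c s b Ss] _ IH]; first by rewrite mul0r; exact: lspan0.
rewrite mulrDl -scalerAl -[c * s * b * a]mulrA; apply: lspan_lin IH.
exact: IdealGen.
Qed.

Let pi : A -> quotalg := @qpi _ _ ideal_gen.
Let qmul (x y : quotalg) : quotalg := pi (repr x * repr y).
Let piM a b : qmul (pi a) (pi b) = pi (a * b).
Proof.
apply/qpiP; set a' := repr _; set b' := repr _.
have -> : a' * b' - a * b = (a' - a) * b' + a * (b' - b).
  by rewrite mulrBl mulrBr addrA subrK.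
by apply: lspanD; [apply: ideal_mulr|apply: ideal_mull]; exact: lspan_repr.
Qed.
Let piD a b : pi a + pi b = pi (a + b).
Proof. by rewrite -[RHS]/(qpi _ _) linearD. Qed.

Fact qmulA : associative qmul.
Proof. by do 3![elim/qpi_surj => ?]; rewrite -!/(pi _) !piM mulrA. Qed.
Fact qmul1r : left_id (pi 1) qmul.
Proof. by elim/qpi_surj => ?; rewrite -!/(pi _) piM mul1r. Qed.
Fact qmulr1 : right_id (pi 1) qmul.
Proof. by elim/qpi_surj => ?; rewrite -!/(pi _) piM mulr1. Qed.
Fact qmulDl : left_distributive qmul +%R.
Proof. by do 3![elim/qpi_surj => ?]; rewrite -!/(pi _) !(piD, piM) mulrDl. Qed.
Fact qmulDr : right_distributive qmul +%R.
Proof. by do 3![elim/qpi_surj => ?]; rewrite -!/(pi _) !(piD, piM) mulrDr. Qed.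
HB.instance Definition _ := GRing.Zmodule_isPzRing.Build quotalg
  qmulA qmul1r qmulr1 qmulDl qmulDr.

Definition quot_pi (a : A) : quotalg := qpi _ a.
Fact quot_pi_linear : linear quot_pi.
Proof. exact: qpi_is_linear. Qed.
HB.instance Definition _ :=
  GRing.isLinear.Build K A quotalg *:%R quot_pi quot_pi_linear.
Fact quot_pi_monoid : monoid_morphism quot_pi.
Proof. by split=> // a b; rewrite -[RHS]/(qmul _ _) -!/(pi _) piM. Qed.
HB.instance Definition _ :=
  GRing.isMonoidMorphism.Build A quotalg quot_pi quot_pi_monoid.

Lemma quot_scaleAl k (x y : quotalg) : k *: (x * y) = (k *: x) * y.
Proof.
elim/qpi_surj: x => a; elim/qpi_surj: y => b; rewrite -!/(quot_pi _).
by rewrite -rmorphM -!linearZ_LR -rmorphM scalerAl.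
Qed.
Lemma quot_scaleAr k (x y : quotalg) : k *: (x * y) = x * (k *: y).
Proof.
elim/qpi_surj: x => a; elim/qpi_surj: y => b; rewrite -!/(quot_pi _).
by rewrite -rmorphM -!linearZ_LR -rmorphM scalerAr.
Qed.
End QuotientAlgebra.

Record derivation (K : fieldType) (B : algType K) := Derivation {
  der_fun :> {linear B -> B};
  derM : forall a b, der_fun (a * b) = der_fun a * b + a * der_fun b
}.

Section Ore.
Variables (K : fieldType) (B : algType K) (d : derivation B).

Inductive ore_rel : freealg B -> Prop :=
  OreRel b : ore_rel
    (free_var B * free_base b - free_base b * free_var B - free_base (d b)).

Definition ore : Type := quotalg ore_rel.
HB.instance Definition _ := GRing.Lmodule.on ore.
HB.instance Definition _ := GRing.PzRing.on ore.

(* B[x; d] acts on B, x acting as d; hence it is not trivial. *)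
Let ev : fx_term B -> B -> B := fix ev t :=
  match t with
  | fx_base b => fun c => b * c
  | fx_var => d
  | fx_add s t => fun c => ev s c + ev t c
  | fx_mul s t => fun c => ev s (ev t c)
  end.

Let ev_linear t : linear (ev t).
Proof.
elim: t => /= [b||s IHs t IHt|s IHs t IHt] k a c.
- by rewrite mulrDr scalerAr.
- exact: linearP.
- by rewrite IHs IHt scalerDr addrACA.
- by rewrite IHt IHs.
Qed.

Let ev_eq s t : fx_eq s t -> ev s =1 ev t.
Proof.
have evD u a b : ev u (a + b) = ev u a + ev u b.
  by have := ev_linear u 1 a b; rewrite !scale1r.
have evZ u k a : ev u (k *: a) = k *: ev u a.
  exact: (linearZ_LR (mklinear (ev_linear u))).
elim=> //=.
- by move=> {}s {}t _ IH c.
- by move=> {}s {}t u _ IH _ IH' c; rewrite IH.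
- by move=> {}s s' {}t t' _ IH _ IH' c; rewrite IH IH'.
- by move=> {}s s' {}t t' _ IH _ IH' c; rewrite IH IH'.
- by move=> a b c; rewrite mulrDl.
- by move=> a b c; rewrite mulrA.
- by move=> *; move=> c; rewrite addrA.
- by move=> *; move=> c; rewrite addrC.
- by move=> *; move=> c; rewrite mul0r add0r.
- by move=> *; move=> c; rewrite mulN1r addNr mul0r.
- by move=> *; move=> c; rewrite mul1r.
- by move=> *; move=> c; rewrite mul1r.
- by move=> *; move=> c; rewrite evD.
- by move=> k u c; rewrite -!scalerAl !mul1r evZ.
Qed.

Fact ore_one_neq0 : (1 : ore) != 0.
Proof.
pose E (u : freealg B) := ev (repr u).
have Epi t : E (\pi_(freealg B) t) =1 ev t.
  move=> c; apply: ev_eq; apply/asboolP.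
  by have /eqP := reprK (\pi_(freealg B) t); rewrite (eqmodE (fx_equiv B)).
have ED u v c : E (u + v) c = E u c + E v c by rewrite -[u + v]/(\pi_(freealg B) (fx_add (repr u) (repr v))) Epi.
have EM u v c : E (u * v) c = E u (E v c) by rewrite -[u * v]/(\pi_(freealg B) (fx_mul (repr u) (repr v))) Epi.
have E0 u : E u 0 = 0 by exact: (linear0 (mklinear (ev_linear (repr u)))).
have Eb b c : E (free_base b) c = b * c by rewrite Epi.
have EZ k u c : E (k *: u) c = k *: E u c.
  by rewrite -[k *: u]/(free_base k%:A * u) EM Eb -scalerAl mul1r.
have EN u c : E (- u) c = - E u c by rewrite -scaleN1r EZ scaleN1r.
have Espan u : lspan (ideal_gen ore_rel) u -> forall c, E u c = 0.
  elim=> [c|k v w [a s b [e]] _ IH c].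
    by rewrite -[X in E X]/(free_base 0) Eb mul0r.
  rewrite ED IH EZ !EM !ED !EN !EM !Eb [E (free_var B) _]Epi [E (free_var B) _]Epi /=.
  by rewrite derM addrK subrr E0 scaler0 addr0.
apply/eqP => /qpiP; rewrite subr0 => /Espan /(_ 1) /eqP.
by rewrite -[X in E X]/(free_base 1) Eb mulr1 oner_eq0.
Qed.

HB.instance Definition _ := GRing.PzSemiRing_isNonZero.Build ore ore_one_neq0.
HB.instance Definition _ :=
  GRing.Lmodule_isLalgebra.Build K ore (@quot_scaleAl K _ ore_rel).
HB.instance Definition _ :=
  GRing.Lalgebra_isAlgebra.Build K ore (@quot_scaleAr K _ ore_rel).

Definition ore_var : ore := quot_pi ore_rel (free_var B).
Definition ore_base (b : B) : ore := quot_pi ore_rel (free_base b).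

Fact ore_base_linear : linear ore_base.
Proof. by move=> k a b; rewrite /ore_base !linearP. Qed.
HB.instance Definition _ :=
  GRing.isLinear.Build K B ore *:%R ore_base ore_base_linear.
Fact ore_base_monoid : monoid_morphism ore_base.
Proof. by split=> [|a b]; rewrite /ore_base ?rmorph1 // !rmorphM. Qed.
HB.instance Definition _ :=
  GRing.isMonoidMorphism.Build B ore ore_base ore_base_monoid.

Lemma ore_relE b : ore_var * ore_base b - ore_base b * ore_var = ore_base (d b).
Proof.
have g0 : ideal_gen ore_rel
    (1 * (free_var B * free_base b - free_base b * free_var B - free_base (d b)) * 1).
  exact: IdealGen.
have /eqP := qpi_eq0 g0; rewrite mulr1 mul1r -/(quot_pi _ _) linearB subr_eq0 => /eqP.
by rewrite linearB /= !rmorphM.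
Qed.
End Ore.

(* Main.v *)
Require Import Defs.
From HB Require Import structures.
From mathcomp Require Import all_boot all_order all_algebra.
From mathcomp Require Import generic_quotient boolp.

Set Implicit Arguments.
Unset Strict Implicit.
Unset Printing Implicit Defensive.

Import GRing.Theory.
Local Open Scope ring_scope.
Local Open Scope quotient_scope.

(** Everything rests on the universal property of the Ore extension H = B[x; d]
    for modules: an H-module is a B-module with a linear operator X satisfying
    X (b m) = b (X m) + d(b) m, and a linear map commuting with B and with X is
    H-linear.

    Bialgebra structure.  As d is a coderivation killed by the counit, the
    operator x (x) 1 + 1 (x) x on H (x) H, and 0 on K, satisfy this rule for the
    diagonal action of B ([tprimJ], [umod_zeroJ]).  Hence H acts on H (x) H and
    on K; the coproduct and the counit of h are h (1 (x) 1) and h 1.  Every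
    element of H is a sum of elements x^n b ([ore_spanP]), so each bialgebra
    axiom has to be checked on B, where it is known, and to be stable under
    left multiplication by x, where it reduces to an identity about operators
    of the form g (x) 1 + 1 (x) k.

    Bimonad.  For any bialgebra map f, the structure maps of H (x)_B - other than
    the unit are H-linear, not only B-linear.  An H-linear map out of H (x)_B M is determined
    by its values on the elements 1 (x) m ([ext_hom_eq]), and on these every
    bimonad axiom is a one-line computation.

    Fusion operators.  For an H-module Z the fusion operator is the H-linear map
    H (x)_B (X (x) Z) -> (H (x)_B X) (x) Z with 1 (x) (m (x) z) |-> (1 (x) m) (x) z.
    To invert it, put V = H (x)_B (X (x) Z) and consider the internal Hom
    E = Hom_B(B (x) Z, V) of B-modules.  B itself is an H-module on which x acts
    by d, so x acts on B (x) Z and on V; the commutator g |-> x g - g x preserves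
    B-linearity and turns E into an H-module ([adJ]).  The B-linear map X -> E
    adjoint to X (x) Z -> V extends to an H-linear map G : H (x)_B X -> E, and the
    inverse is t (x) z |-> G(t)(1 (x) z).  It is H-linear, which gives one composite;
    the other follows by induction on x^n b, from
    x t (x) z = x (t (x) z) - t (x) x z. *)

(** * Additivity of actions *)

Lemma actDl (K : fieldType) (A : algType K) (M : amod A) (a b : A) (m : M) :
  act (a + b) m = act a m + act b m.
Proof. exact: (linearD (mklinear ((act_bilinear M).1 m))). Qed.

Lemma actDr (K : fieldType) (A : algType K) (M : amod A) (a : A) (m n : M) :
  act a (m + n) = act a m + act a n.
Proof. exact: (linearD (actl M a)). Qed.

Lemma actBr (K : fieldType) (A : algType K) (M : amod A) (a : A) (m n : M) :
  act a (m - n) = act a m - act a n.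
Proof. exact: (linearB (actl M a)). Qed.

Lemma act0l (K : fieldType) (A : algType K) (M : amod A) (m : M) :
  act (0 : A) m = 0.
Proof. exact: (linear0 (mklinear ((act_bilinear M).1 m))). Qed.

(** * Ore extensions and their modules *)

Record action_extension (K : fieldType) (B H : algType K)
    (f : {lrmorphism B -> H}) (x : H) (M : amod B) (X : M -> M) := ActionExtension {
  ext_action : H -> M -> M;
  ext_action_bilinear : bilinear_for *:%R *:%R ext_action;
  ext_action1 : forall m, ext_action 1 m = m;
  ext_actionM : forall g h m, ext_action (g * h) m = ext_action g (ext_action h m);
  ext_action_base : forall b m, ext_action (f b) m = act b m;
  ext_action_var : forall m, ext_action x m = X m
}.

(** What the rest of the development uses of H = B[x; d].  Working with an
    arbitrary algebra having these properties keeps the explicit quotient out of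
    all later conversion problems.  The induction principle says that H is
    spanned by the elements x^n b; the last field is the universal property of
    B[x; d], phrased for modules rather than for algebra maps because it will be
    applied to H (x) H and to Hom spaces, where no algebra structure is at hand. *)
Record ore_extension (K : fieldType) (B : algType K) (d : derivation B)
    (H : algType K) (f : {lrmorphism B -> H}) (x : H) := OreExtension {
  ore_ext_varM : forall b, x * f b = f b * x + f (d b);
  ore_ext_ind : forall P : H -> Prop, (forall b, P (f b)) ->
    (forall u, P u -> P (x * u)) -> (forall u v, P u -> P v -> P (u + v)) ->
    forall h, P h;
  ore_ext_action : forall (M : amod B) (X : {linear M -> M}),
    (forall b m, X (act b m) = act b (X m) + act (d b) m) ->
    action_extension f x X
}.

Section Ore.
Variables (K : fieldType) (B : algType K) (d : derivation B).

Lemma der1 : d 1 = 0.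
Proof. by apply: (addrI (d 1)); rewrite addr0 -[in RHS](mulr1 1) derM mulr1 mul1r. Qed.

(** B[x; d] is generated as a ring by B and x, since the free algebra is. *)
Lemma ore_ind (P : ore d -> Prop) :
  (forall b, P (ore_base d b)) -> P (ore_var d) ->
  (forall u v, P u -> P v -> P (u + v)) -> (forall u v, P u -> P v -> P (u * v)) ->
  forall h, P h.
Proof.
move=> Pb Px PD PM; elim/qpi_surj; elim/free_ind => [b||u v Pu Pv|u v Pu Pv].
- exact: Pb.
- exact: Px.
- by rewrite linearD; exact: PD.
- rewrite -/(quot_pi _ _) rmorphM; exact: PM.
Qed.

Lemma ore_varM b : ore_var d * ore_base d b =
  ore_base d b * ore_var d + ore_base d (d b).
Proof. by rewrite -ore_relE addrC subrK. Qed.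

Inductive ore_span : ore d -> Prop :=
| ore_span_base b : ore_span (ore_base d b)
| ore_span_var u : ore_span u -> ore_span (ore_var d * u)
| ore_spanD u v : ore_span u -> ore_span v -> ore_span (u + v).

(** By the rule b x = x b - d(b), the span of the x^n b is stable under left
    multiplication by B; being stable under x as well, it is a left ideal, and
    it contains 1. *)
Lemma ore_spanP h : ore_span h.
Proof.
have baseM u : ore_span u -> forall b, ore_span (ore_base d b * u).
  elim=> [c|{}u _ IH|{}u v _ IHu _ IHv] b.
  - by rewrite -rmorphM; exact: ore_span_base.
  - have -> : ore_base d b * (ore_var d * u) =
        ore_var d * (ore_base d b * u) + ore_base d (- d b) * u.
      by rewrite !mulrA ore_varM linearN mulrDl mulNr addrK.
    by apply: ore_spanD => //; apply: ore_span_var.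
  - by rewrite mulrDr; exact: ore_spanD.
suff IH u : ore_span u -> ore_span (h * u).
  by rewrite -[h]mulr1 -(rmorph1 (ore_base d)); apply/IH/ore_span_base.
elim/ore_ind: h u => [b||g h IHg IHh|g h IHg IHh] u Su.
- exact: baseM.
- exact: ore_span_var.
- by rewrite mulrDl; apply: ore_spanD; [exact: IHg|exact: IHh].
- by rewrite -mulrA; apply/IHg/IHh.
Qed.

Section OreModule.
Variables (M : amod B) (X : {linear M -> M}).
Hypothesis XJ : forall b m, X (act b m) = act b (X m) + act (d b) m.

(* Terms are interpreted as operators on M; the congruence defining the free
   algebra and the Ore relators act trivially, so this descends to B[x; d]. *)
Let ev : fx_term B -> {linear M -> M} := fix ev t :=
  match t with
  | fx_base b => actl M b
  | fx_var => X
  | fx_add s t => ev s \+ ev t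
  | fx_mul s t => ev s \o ev t
  end.

Let ev_eq s t : fx_eq s t -> ev s =1 ev t.
Proof.
elim=> //=.
- by move=> {}s {}t _ IH m; rewrite IH.
- by move=> {}s {}t u _ IHs _ IHt m; rewrite IHs.
- by move=> {}s s' {}t t' _ IHs _ IHt m; rewrite /= IHs IHt.
- by move=> {}s s' {}t t' _ IHs _ IHt m; rewrite /= IHs IHt.
- by move=> a b m; rewrite /= actDl.
- by move=> a b m; rewrite /= actM.
- by move=> *; move=> m; rewrite /= addrA.
- by move=> *; move=> m; rewrite /= addrC.
- by move=> *; move=> m; rewrite /= act0l add0r.
- by move=> u m; rewrite /= -scaleN1r actZl act1 scaleN1r addNr act0l.
- by move=> u m; rewrite /= act1.
- by move=> u m; rewrite /= act1.
- by move=> *; move=> m; rewrite /= linearD.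
- by move=> k u m; rewrite /= !actZl !act1 linearZ_LR.
Qed.

Let evf (u : freealg B) (m : M) : M := ev (repr u) m.

Let evf_pi t m : evf (\pi_(freealg B) t) m = ev t m.
Proof.
apply: ev_eq; apply/asboolP.
by have /eqP := reprK (\pi_(freealg B) t); rewrite (eqmodE (fx_equiv B)).
Qed.

Let evfD u v m : evf (u + v) m = evf u m + evf v m.
Proof. exact: (evf_pi (fx_add (repr u) (repr v))). Qed.

Let evfM u v m : evf (u * v) m = evf u (evf v m).
Proof. exact: (evf_pi (fx_mul (repr u) (repr v))). Qed.

Let evf_base b m : evf (free_base b) m = act b m.
Proof. exact: evf_pi. Qed.

Let evfZ k u m : evf (k *: u) m = k *: evf u m.
Proof. by rewrite -[k *: u]/(free_base k%:A * u) evfM evf_base actZl act1. Qed.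

Let evf_linear m : linear (fun u => evf u m).
Proof. by move=> k u v; rewrite evfD evfZ. Qed.

Let evf_ideal m u : ideal_gen (@ore_rel K B d) u -> evf u m = 0.
Proof.
case=> a _ c [b]; rewrite !evfM !evfD -!scaleN1r !evfZ !scaleN1r !evfM.
rewrite !evf_base ![evf (free_var B) _]evf_pi /= XJ.
by rewrite [act b _ + _]addrC addrK subrr [LHS]linear0.
Qed.

Definition ore_act (h : ore d) (m : M) : M := qlift (fun u => evf u m) h.

Let ore_actE u m : ore_act (quot_pi _ u) m = evf u m.
Proof. exact: (qliftE (evf_linear m) (@evf_ideal m)). Qed.

Let ore_act_bilinear : bilinear_for *:%R *:%R ore_act.
Proof.
split=> [m|h]; first exact: (qlift_linear (evf_linear m) (@evf_ideal m)).
by move=> k m m'; rewrite /ore_act /qlift /evf linearP.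
Qed.

Let ore_act1 m : ore_act 1 m = m.
Proof. by rewrite [LHS]ore_actE -(rmorph1 (@free_base K B)) evf_base act1. Qed.

Let ore_actM g h m : ore_act (g * h) m = ore_act g (ore_act h m).
Proof.
elim/qpi_surj: g => u; elim/qpi_surj: h => v.
by rewrite -!/(quot_pi _ _) -rmorphM !ore_actE evfM.
Qed.

Let ore_act_base b m : ore_act (ore_base d b) m = act b m.
Proof. by rewrite [LHS]ore_actE evf_base. Qed.

Let ore_act_var m : ore_act (ore_var d) m = X m.
Proof. by rewrite [LHS]ore_actE [LHS]evf_pi. Qed.

Definition ore_action : action_extension (ore_base d) (ore_var d) X :=
  ActionExtension ore_act_bilinear ore_act1 ore_actM ore_act_base ore_act_var.
End OreModule.

Definition ore_presentation : ore_extension d (ore_base d) (ore_var d) :=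
  OreExtension ore_varM
    (fun P Pb Px PD h => ore_span_ind Pb (fun u _ => Px u)
       (fun u v _ Pu _ => PD u v Pu) (ore_spanP h))
    ore_action.
End Ore.

(** * Operators on tensor products *)

Lemma pureDl (K : fieldType) (U V : lmodType K) (u u' : U) (v : V) :
  pure (u + u') v = pure u v + pure u' v.
Proof. exact: (linearD (mklinear ((pure_bilinear U V).1 v))). Qed.

Lemma pureDr (K : fieldType) (U V : lmodType K) (u : U) (v v' : V) :
  pure u (v + v') = pure u v + pure u v'.
Proof. exact: (linearD (mklinear ((pure_bilinear U V).2 u))). Qed.

Lemma pure0r (K : fieldType) (U V : lmodType K) (u : U) :
  pure u (0 : V) = 0.
Proof. exact: (linear0 (mklinear ((pure_bilinear U V).2 u))). Qed.

Lemma pure0l (K : fieldType) (U V : lmodType K) (v : V) :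
  pure (0 : U) v = 0.
Proof. exact: (linear0 (mklinear ((pure_bilinear U V).1 v))). Qed.

Lemma tensor_lin_ext (K : fieldType) (U V W : lmodType K)
    (g k : {linear tensor U V -> W}) :
  (forall u v, g (pure u v) = k (pure u v)) -> g =1 k.
Proof.
by apply: tensor_ext => c s t; rewrite linearP.
Qed.

Lemma tensor3_lin_ext (K : fieldType) (U V W Z : lmodType K)
    (g k : {linear tensor (tensor U V) W -> Z}) :
  (forall u v w, g (pure (pure u v) w) = k (pure (pure u v) w)) -> g =1 k.
Proof.
move=> gk; apply: tensor_lin_ext => t w.
elim/tensor_ind: t => [u v|c s t IH IH']; first exact: gk.
by rewrite purePl !linearP IH IH'.
Qed.

(** Functoriality of the tensor product on commutative squares.  Stated with four
    factors, it replaces rewriting with composition laws for linear maps. *)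
Lemma tmap_square (K : fieldType) (U V U1 V1 U2 V2 U' V' : lmodType K)
    (p1 : {linear U -> U1}) (p2 : {linear U1 -> U'})
    (q1 : {linear U -> U2}) (q2 : {linear U2 -> U'})
    (r1 : {linear V -> V1}) (r2 : {linear V1 -> V'})
    (s1 : {linear V -> V2}) (s2 : {linear V2 -> V'}) :
  (forall u, p2 (p1 u) = q2 (q1 u)) -> (forall v, r2 (r1 v) = s2 (s1 v)) ->
  forall t, tmap p2 r2 (tmap p1 r1 t) = tmap q2 s2 (tmap q1 s1 t).
Proof.
move=> pq rs; apply: (tensor_lin_ext (g := tmap p2 r2 \o tmap p1 r1)
  (k := tmap q2 s2 \o tmap q1 s1)) => u v.
rewrite -[LHS]/(tmap _ _ (tmap _ _ _)) -[RHS]/(tmap _ _ (tmap _ _ _)).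
by rewrite !tmapE pq rs.
Qed.

Lemma tassoc_natural (K : fieldType) (U V W U' V' W' : lmodType K)
    (p : {linear U -> U'}) (q : {linear V -> V'}) (r : {linear W -> W'}) t :
  tassoc U' V' W' (tmap (tmap p q) r t) = tmap p (tmap q r) (tassoc U V W t).
Proof.
move: t; apply: (tensor3_lin_ext (g := tassoc U' V' W' \o tmap (tmap p q) r)
  (k := tmap p (tmap q r) \o tassoc U V W)) => u v w.
rewrite -[LHS]/(tassoc _ _ _ (tmap _ _ _)) -[RHS]/(tmap _ _ (tassoc _ _ _ _)).
by rewrite tmapE tassocE !tmapE tassocE.
Qed.

Section Primitive.
Variable K : fieldType.

(** The operator g (x) 1 + 1 (x) k.  With g and k the actions of a primitive
    element x on two modules, this is its action on their tensor product; with
    g = k = d it is the right-hand side of the coderivation rule. *)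
Definition tprim (U V : lmodType K) (g : {linear U -> U}) (k : {linear V -> V}) :
  {linear tensor U V -> tensor U V} := tmap g idfun \+ tmap idfun k.

Lemma tprimE (U V : lmodType K) (g : {linear U -> U}) (k : {linear V -> V}) u v :
  tprim g k (pure u v) = pure (g u) v + pure u (k v).
Proof. by rewrite -[LHS]/(tmap _ _ _ + tmap _ _ _) !tmapE. Qed.

Lemma tprim_tmap (U V U' V' : lmodType K) (g : {linear U -> U})
    (k : {linear V -> V}) (g' : {linear U' -> U'}) (k' : {linear V' -> V'})
    (p : {linear U -> U'}) (q : {linear V -> V'}) :
  (forall u, p (g u) = g' (p u)) -> (forall v, q (k v) = k' (q v)) ->
  forall t, tmap p q (tprim g k t) = tprim g' k' (tmap p q t).
Proof.
move=> pg qk; apply: (tensor_lin_ext (g := tmap p q \o tprim g k)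
  (k := tprim g' k' \o tmap p q)) => u v.
rewrite -[LHS]/(tmap _ _ (tprim _ _ _)) -[RHS]/(tprim _ _ (tmap _ _ _)).
by rewrite tprimE (linearD (tmap p q)) !tmapE tprimE pg qk.
Qed.

Lemma tprim_assoc (U V W : lmodType K) (g : {linear U -> U})
    (k : {linear V -> V}) (l : {linear W -> W}) t :
  tassoc U V W (tprim (tprim g k) l t) = tprim g (tprim k l) (tassoc U V W t).
Proof.
move: t; apply: (tensor3_lin_ext (g := tassoc U V W \o tprim (tprim g k) l)
  (k := tprim g (tprim k l) \o tassoc U V W)) => u v w.
rewrite -[LHS]/(tassoc _ _ _ (tprim _ _ _)) -[RHS]/(tprim _ _ (tassoc _ _ _ _)).
rewrite !tprimE pureDl !(linearD (tassoc U V W)) !tassocE !tprimE.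
by rewrite pureDr addrA.
Qed.

(** Counitality of a primitive element: it acts by 0 on the unit object. *)
Lemma tprim_lunit (V : lmodType K) (g : {linear K^o -> K^o})
    (k : {linear V -> V}) t :
  (forall c, g c = 0) -> tlunit V (tprim g k t) = k (tlunit V t).
Proof.
move=> g0; move: t; apply: (tensor_lin_ext (g := tlunit V \o tprim g k)
  (k := k \o tlunit V)) => c v.
rewrite -[LHS]/(tlunit _ (tprim _ _ _)) -[RHS]/(k (tlunit _ _)).
by rewrite tprimE g0 pure0l add0r !tlunitE linearZ_LR.
Qed.

Lemma tprim_runit (V : lmodType K) (k : {linear V -> V})
    (g : {linear K^o -> K^o}) t :
  (forall c, g c = 0) -> trunit V (tprim k g t) = k (trunit V t).
Proof.
move=> g0; move: t; apply: (tensor_lin_ext (g := trunit V \o tprim k g)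
  (k := k \o trunit V)) => v c.
rewrite -[LHS]/(trunit _ (tprim _ _ _)) -[RHS]/(k (trunit _ _)).
by rewrite tprimE g0 pure0r addr0 !trunitE linearZ_LR.
Qed.
End Primitive.

Section PactAdditive.
Variables (K : fieldType) (A A' : algType K) (M : amod A) (N : amod A').

Lemma pactDl z z' (t : tensor M N) : pact (z + z') t = pact z t + pact z' t.
Proof. exact: (linearD (mklinear ((pact_bilinear M N).1 t))). Qed.

Lemma pactDr z (t t' : tensor M N) : pact z (t + t') = pact z t + pact z t'.
Proof. exact: (linearD (mklinear ((pact_bilinear M N).2 z))). Qed.
End PactAdditive.

Lemma pact_res (K : fieldType) (A H : algType K) (f : {lrmorphism A -> H})
    (M N : amod H) (z : tensor A A) (t : tensor M N) :
  @pact K A A (res_mod f M) (res_mod f N) z t = pact (tmap f f z) t.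
Proof.
elim/tensor_ind: z => [a a'|k z z' IH IH']; last first.
  by rewrite pactPl linearP pactPl IH IH'.
elim/tensor_ind: t => [x y|k t t' IH IH']; last by rewrite !pactPr IH IH'.
by rewrite tmapE !pact_pure.
Qed.

(** * The bialgebra structure of an Ore extension *)

Section OreBialgebra.
Variables (K : fieldType) (B : algType K) (d : derivation B).
Variables (H : algType K) (f : {lrmorphism B -> H}) (x : H).
Hypothesis oreH : ore_extension d f x.

Lemma ore_equivariant (M N : amod H) (phi : {linear M -> N}) :
  (forall b m, phi (act (f b) m) = act (f b) (phi m)) ->
  (forall m, phi (act x m) = act x (phi m)) ->
  forall h m, phi (act h m) = act h (phi m).
Proof.
move=> phib phix; elim/(ore_ext_ind oreH) => // [u IH|u v IHu IHv] m.
  by rewrite !actM phix IH.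
by rewrite !actDl linearD IHu IHv.
Qed.

Section OreModule.
Variables (M : amod B) (X : {linear M -> M}).
Hypothesis XJ : forall b m, X (act b m) = act b (X m) + act (d b) m.
Let E := ore_ext_action oreH XJ.

Definition ore_amod : amod H :=
  AMod (ext_action_bilinear E) (ext_action1 E) (ext_actionM E).

Lemma ore_amod_base b (m : M) : act (f b) (m : ore_amod) = act b m.
Proof. exact: (ext_action_base E). Qed.

Lemma ore_amod_var (m : M) : act x (m : ore_amod) = X m.
Proof. exact: (ext_action_var E). Qed.
End OreModule.

Variable bB : bialgebra B.
Hypothesis d_comul : forall b : B, comul bB (d b) =
  tmap d idfun (comul bB b) + tmap idfun d (comul bB b).
Hypothesis d_counit : forall b : B, counit bB (d b) = 0.

(** This is where d being a coderivation enters: the tensor product of two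
    B-modules with an x-operator again carries one. *)
Lemma tprimJ (M N : amod B) (X : {linear M -> M}) (Y : {linear N -> N}) :
  (forall b m, X (act b m) = act b (X m) + act (d b) m) ->
  (forall b n, Y (act b n) = act b (Y n) + act (d b) n) ->
  forall b (t : tmod bB M N),
    tprim X Y (act b t) = act b (tprim X Y t : tmod bB M N) + act (d b) t.
Proof.
move=> XJ YJ b t; rewrite !tmodE d_comul -[tmap d idfun _ + _]/(tprim d d _).
elim/tensor_ind: (comul bB b) => [a a'|k z z' IH IH']; last first.
  by rewrite !(linearP (tprim _ _)) !pactPl linearP IH IH' scalerDr addrACA.
elim/tensor_ind: t => [m n|k t t' IH IH']; last first.
  by rewrite pactPr !(linearP (tprim X Y)) !pactPr IH IH' scalerDr addrACA.
rewrite pact_pure !tprimE pactDl pactDr !pact_pure XJ YJ pureDl pureDr.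
by rewrite addrACA.
Qed.

Lemma res_varJ (N : amod H) b (n : res_mod f N) :
  actl N x (act b n) = act b (actl N x n : res_mod f N) + act (d b) n.
Proof. by rewrite !actlE !res_modE -!actM (ore_ext_varM oreH) actDl. Qed.

Lemma umod_zeroJ b (k : umod bB) : (\0 : {linear umod bB -> umod bB}) (act b k) =
  act b ((\0 : {linear umod bB -> umod bB}) k) + act (d b) k.
Proof.
by rewrite -[RHS]/(counit bB b * 0 + counit bB (d b) * k) d_counit mulr0 mul0r addr0.
Qed.

Definition ore_unit : amod H := ore_amod umod_zeroJ.

Let lx : {linear H -> H} := actl (regular H) x.

(** H (x) H with the diagonal action of B, and x acting by x (x) 1 + 1 (x) x.  The
    coproduct is the orbit map of 1 (x) 1, so that multiplicativity will express
    that the action is by left multiplication. *)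
Definition ore_comul_amod : amod H :=
  ore_amod (tprimJ (X := lx) (Y := lx)
    (M := res_mod f (regular H)) (N := res_mod f (regular H))
    (@res_varJ (regular H)) (@res_varJ (regular H))).

Definition ore_comul_fun (h : H) : tensor H H := act h (pure 1 1 : ore_comul_amod).

Lemma ore_comul_linear : linear ore_comul_fun.
Proof. by move=> k g h; rewrite /ore_comul_fun actPl. Qed.

Definition ore_comul : {linear H -> tensor H H} := mklinear ore_comul_linear.

Lemma ore_comul1 : ore_comul 1 = pure 1 1.
Proof. exact: (act1 (pure 1 1 : ore_comul_amod)). Qed.

Lemma ore_comul_baseM b u :
  ore_comul (f b * u) = tmul (tmap f f (comul bB b)) (ore_comul u).
Proof.
transitivity (act (f b) (ore_comul u : ore_comul_amod)).
  exact: (actM (f b) u (pure 1 1 : ore_comul_amod)).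
by rewrite ore_amod_base tmodE pact_res.
Qed.

Lemma ore_comul_varM u : ore_comul (x * u) = tprim lx lx (ore_comul u).
Proof.
transitivity (act x (ore_comul u : ore_comul_amod)).
  exact: (actM x u (pure 1 1 : ore_comul_amod)).
by rewrite ore_amod_var.
Qed.

Lemma ore_comul_base b : ore_comul (f b) = tmap f f (comul bB b).
Proof. by rewrite -[f b]mulr1 ore_comul_baseM ore_comul1 tmulr1. Qed.

Lemma ore_comul_var : ore_comul x = pure x 1 + pure 1 x.
Proof. by rewrite -[x in LHS]mulr1 ore_comul_varM ore_comul1 tprimE /= mulr1. Qed.

Lemma tprim_mull (s t : tensor H H) : tprim lx lx (tmul s t) = tmul (tprim lx lx s) t.
Proof.
suff mul t' : tprim lx lx t' = tmul (pure x 1 + pure 1 x) t' by rewrite !mul tmulA.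
move: t'; apply: tensor_ext => [k u v|k u v|u v]; first by rewrite linearP.
  exact: (@pactPr _ _ _ (regular H) (regular H)).
by rewrite tprimE tmulDl !tmulE !mul1r.
Qed.

Lemma ore_comulM g h : ore_comul (g * h) = tmul (ore_comul g) (ore_comul h).
Proof.
elim/(ore_ext_ind oreH): g => [b|u IH|u v IHu IHv].
- by rewrite ore_comul_baseM ore_comul_base.
- by rewrite -mulrA !ore_comul_varM IH tprim_mull.
- by rewrite mulrDl !linearD IHu IHv tmulDl.
Qed.

Lemma ore_comul_monoid : monoid_morphism ore_comul.
Proof. by split; [exact: ore_comul1|exact: ore_comulM]. Qed.

(** For elements of B this is coassociativity of B carried along f; multiplying
    by x on the left applies x (x) 1 (x) 1 + 1 (x) x (x) 1 + 1 (x) 1 (x) x to both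
    sides. *)
Lemma ore_comulA h : tassoc H H H (tmap ore_comul idfun (ore_comul h)) =
  tmap idfun ore_comul (ore_comul h).
Proof.
elim/(ore_ext_ind oreH): h => [b|u IH|u v IHu IHv].
- rewrite ore_comul_base.
  rewrite (tmap_square (q1 := comul bB) (q2 := tmap f f) (s1 := idfun) (s2 := f)) //;
    last exact: ore_comul_base.
  rewrite tassoc_natural comulA.
  by apply: tmap_square => // c; rewrite ore_comul_base.
- rewrite ore_comul_varM.
  rewrite (tprim_tmap (g' := tprim lx lx) (k' := lx)) //; last exact: ore_comul_varM.
  rewrite (tprim_tmap (g' := lx) (k' := tprim lx lx)) //; last exact: ore_comul_varM.
  by rewrite tprim_assoc IH.
- by rewrite !linearD IHu IHv.
Qed.

(** Here also multiplicativity is associativity of the action, as H acts on the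
    line K by scalars. *)
Definition ore_counit_fun (h : H) : K^o := act h (1 : ore_unit).

Lemma ore_counit_linear : linear ore_counit_fun.
Proof. exact: (act_bilinear ore_unit).1. Qed.

Lemma ore_unitE h (k : ore_unit) : act h k = (ore_counit_fun h * k : K^o).
Proof.
transitivity (act h ((k : K) *: (1 : ore_unit))); first by congr act; exact/esym/mulr1.
by rewrite actZr [RHS]mulrC.
Qed.

Lemma ore_counit_monoid : monoid_morphism ore_counit_fun.
Proof.
split=> [|g h]; first exact: (act1 (1 : ore_unit)).
by rewrite [LHS]actM ore_unitE.
Qed.

Definition ore_counit : {lrmorphism H -> K^o} :=
  HB.pack ore_counit_fun
    (GRing.isLinear.Build K H K^o *:%R ore_counit_fun ore_counit_linear)
    (GRing.isMonoidMorphism.Build H K^o ore_counit_fun ore_counit_monoid).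

Lemma ore_counit_base b : ore_counit (f b) = counit bB b.
Proof. by rewrite -[LHS]/(act (f b) (1 : ore_unit)) ore_amod_base [LHS]mulr1. Qed.

Lemma ore_counit_var : ore_counit x = 0.
Proof. exact: (ore_amod_var umod_zeroJ 1). Qed.

Lemma ore_counit_varM u : ore_counit (x * u) = 0.
Proof. by rewrite -[LHS]/(act (x * u) (1 : ore_unit)) actM ore_amod_var. Qed.

Lemma ore_counitl h : tlunit H (tmap ore_counit idfun (ore_comul h)) = h.
Proof.
elim/(ore_ext_ind oreH): h => [b|u IH|u v IHu IHv].
- rewrite ore_comul_base -[in RHS](comul_counitl bB b).
  rewrite (tmap_square (q1 := counit bB) (q2 := idfun) (s1 := idfun) (s2 := f)) //;
    last exact: ore_counit_base.
  elim/tensor_ind: (tmap (counit bB) _ _) => [k c|k s t IHs IHt].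
    by rewrite tmapE !tlunitE linearZ_LR.
  by rewrite !linearP IHs IHt.
- rewrite ore_comul_varM (tprim_tmap (g' := \0) (k' := lx)) //.
    by rewrite tprim_lunit // IH.
  exact: ore_counit_varM.
- by rewrite !linearD IHu IHv.
Qed.

Lemma ore_counitr h : trunit H (tmap idfun ore_counit (ore_comul h)) = h.
Proof.
elim/(ore_ext_ind oreH): h => [b|u IH|u v IHu IHv].
- rewrite ore_comul_base -[in RHS](comul_counitr bB b).
  rewrite (tmap_square (q1 := idfun) (q2 := f) (s1 := counit bB) (s2 := idfun)) //;
    last exact: ore_counit_base.
  elim/tensor_ind: (tmap _ (counit bB) _) => [c k|k s t IHs IHt].
    by rewrite tmapE !trunitE linearZ_LR.
  by rewrite !linearP IHs IHt.
- rewrite ore_comul_varM (tprim_tmap (g' := lx) (k' := \0)) //.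
    by rewrite tprim_runit // IH.
  exact: ore_counit_varM.
- by rewrite !linearD IHu IHv.
Qed.

Definition ore_bialgebra : bialgebra H :=
  Bialgebra ore_comul_monoid ore_comulA ore_counitl ore_counitr.

Lemma ore_bialgebra_map : bialgebra_map bB ore_bialgebra f.
Proof. by split; [exact: ore_comul_base|exact: ore_counit_base]. Qed.
End OreBialgebra.

(** * The bimonad of a bialgebra map *)

Section ExtensionBimonad.
Variables (K : fieldType) (B H : algType K).
Variables (bB : bialgebra B) (bH : bialgebra H) (f : {lrmorphism B -> H}).
Hypothesis fbi : bialgebra_map bB bH f.

Local Notation ext := (ext_mod f).
Local Notation res := (res_mod f).
Local Notation eta := (bpure f 1).

Lemma bpure_act (M : amod B) h (m : M) : bpure f h m = act h (eta m : ext M).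
Proof. by rewrite ext_modE mulr1. Qed.

(** The elements 1 (x) m generate H (x)_B M as an H-module.  This reduces every
    bimonad axiom to these generators. *)
Lemma ext_hom_eq (M : amod B) (N : amod H) (g k : amod_hom (ext M) N) :
  (forall m, g (eta m) = k (eta m)) -> forall t, g t = k t.
Proof.
move=> gk; elim/btensor_ind => [h m|c s t IHs IHt].
  by rewrite bpure_act !amod_funJ gk.
by rewrite !linearP IHs IHt.
Qed.

Lemma ext_tens_eq (M M' : amod B) (N : amod H)
    (g k : amod_hom (ext (tmod bB M M')) N) :
  (forall (m : M) (m' : M'),
     g (eta (pure m m' : tmod bB M M')) = k (eta (pure m m' : tmod bB M M'))) ->
  forall t, g t = k t.
Proof.
move=> gk; apply: ext_hom_eq; elim/tensor_ind => [m m'|c s t IHs IHt].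
  exact: gk.
by rewrite bpurePr !linearP IHs IHt.
Qed.

Lemma ext_tens3_eq (M M' M'' : amod B) (N : amod H)
    (g k : amod_hom (ext (tmod bB (tmod bB M M') M'')) N) :
  (forall (m : M) (m' : M') (m'' : M''),
     let t : tmod bB (tmod bB M M') M'' := pure (pure m m' : tmod bB M M') m'' in
     g (eta t) = k (eta t)) ->
  forall t, g t = k t.
Proof.
move=> gk; apply: ext_tens_eq => + m''.
elim/tensor_ind => [m m'|c s t IHs IHt]; first exact: gk.
by rewrite purePl bpurePr !linearP IHs IHt.
Qed.

Lemma ext_mapE (M N : amod B) (g : amod_hom M N) m :
  ext_map f g (eta m) = eta (g m).
Proof. exact: ext_linE. Qed.

Lemma ext_counitE (N : amod H) (n : res N) : ext_counit f N (eta n) = n.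
Proof. rewrite -[LHS]/(ext_counit_lin f N _) ext_counit_linE; exact: act1. Qed.

Section Comultiplication.
Variables X Y : amod B.

Let bl (m : X) : {linear H -> ext X} := mklinear ((bpure_bilinear f X).1 m).
Let br (m : Y) : {linear H -> ext Y} := mklinear ((bpure_bilinear f Y).1 m).

(** The comultiplication of the bimonad is the H-linear extension of
    m (x) n |-> (1 (x) m) (x) (1 (x) n). *)
Lemma ext_comulE h (m : X) (n : Y) :
  ext_comul fbi X Y (bpure f h (pure m n : tmod bB X Y)) =
  act h (pure (eta m) (eta n) : tmod bH (ext X) (ext Y)).
Proof.
transitivity (tmap (bl m) (br n) (comul bH h)); first exact: ext_comul_linE.
rewrite tmodE; elim/tensor_ind: (comul bH h) => [a a'|k s t IHs IHt].
  by rewrite tmapE pact_pure -!bpure_act.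
by rewrite linearP pactPl IHs IHt.
Qed.

Lemma ext_comulJ_ext h (t : ext (tmod bB X Y)) : ext_comul fbi X Y (act h t) =
  act h (ext_comul fbi X Y t : tmod bH (ext X) (ext Y)).
Proof.
elim/btensor_ind: t => [g t|k s t IHs IHt]; last first.
  by rewrite actPr !linearP IHs IHt actPr.
elim/tensor_ind: t => [m n|k s t IHs IHt]; last first.
  by rewrite bpurePr actPr !linearP IHs IHt actPr.
by rewrite ext_modE !ext_comulE actM.
Qed.

Definition ext_comul_hom : amod_hom (ext (tmod bB X Y)) (tmod bH (ext X) (ext Y)) :=
  @AModHom K H (ext (tmod bB X Y)) (tmod bH (ext X) (ext Y))
    (ext_comul fbi X Y) ext_comulJ_ext.

Lemma ext_comul_homE (m : X) (n : Y) :
  ext_comul_hom (eta (pure m n : tmod bB X Y)) = pure (eta m) (eta n).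
Proof. by rewrite [LHS]ext_comulE act1. Qed.
End Comultiplication.

Lemma ext_epsE h (k : umod bB) :
  ext_eps fbi (bpure f h k) = (counit bH h * k : K^o).
Proof. exact: ext_eps_linE. Qed.

Lemma ext_epsJ_ext h (t : ext (umod bB)) :
  ext_eps fbi (act h t) = act h (ext_eps fbi t : umod bH).
Proof.
elim/btensor_ind: t => [g c|k s t IHs IHt]; last first.
  by rewrite actPr !linearP IHs IHt actPr.
by rewrite ext_modE !ext_epsE rmorphM -mulrA.
Qed.

Definition ext_eps_hom : amod_hom (ext (umod bB)) (umod bH) :=
  @AModHom K H (ext (umod bB)) (umod bH) (ext_eps fbi) ext_epsJ_ext.

Lemma ext_eps_homE (k : umod bB) : ext_eps_hom (eta k) = k.
Proof. by rewrite [LHS]ext_epsE rmorph1 mul1r. Qed.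

(* In the proofs below the two sides of an axiom are B-linear composites; the
   explicit [g] and [k] are the same functions seen as H-linear maps. *)
Lemma ext_is_monad : is_monad (ext_bimonad fbi).
Proof.
split.
- move=> X Y g; apply: amod_hom_ext.
  apply: (ext_hom_eq
    (g := amod_comp (ext_counit f (ext Y)) (ext_map f (res_map f (ext_map f g))))
    (k := amod_comp (ext_map f g) (ext_counit f (ext X)))) => t.
  by rewrite !amod_compE ext_mapE !ext_counitE.
- by move=> X Y g; apply: amod_hom_ext => m; rewrite [RHS]ext_mapE.
- move=> X; apply: amod_hom_ext.
  apply: (ext_hom_eq
    (g := amod_comp (ext_counit f (ext X)) (ext_map f (res_map f (ext_counit f (ext X)))))
    (k := amod_comp (ext_counit f (ext X)) (ext_counit f (ext (res (ext X)))))) => t.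
  by rewrite !amod_compE ext_mapE !ext_counitE.
- move=> X; split; apply: amod_hom_ext.
    by move=> t; rewrite [LHS]ext_counitE.
  apply: (ext_hom_eq
    (g := amod_comp (ext_counit f (ext X)) (ext_map f (ext_unit f X)))
    (k := amod_id (ext X))) => m.
  by rewrite !amod_compE ext_mapE !ext_counitE.
Qed.

Lemma ext_is_opmonoidal : is_opmonoidal_functor (ext_bimonad fbi).
Proof.
split.
- move=> X X' Y Y' g k; apply: amod_hom_ext.
  apply: (ext_tens_eq
    (g := amod_comp (ext_comul_hom X' Y') (ext_map f (tmodm bB g k)))
    (k := amod_comp (tmodm bH (ext_map f g) (ext_map f k)) (ext_comul_hom X Y))) => m n.
  rewrite !amod_compE ext_mapE tmodmE !ext_comul_homE tmodmE.
  by rewrite !ext_mapE.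
- move=> X Y Z; apply: amod_hom_ext.
  apply: (ext_tens3_eq
    (g := amod_comp (amod_comp (amassoc bH (ext X) (ext Y) (ext Z))
       (tmodm bH (ext_comul_hom X Y) (amod_id (ext Z)))) (ext_comul_hom (tmod bB X Y) Z))
    (k := amod_comp (amod_comp (tmodm bH (amod_id (ext X)) (ext_comul_hom Y Z))
       (ext_comul_hom X (tmod bB Y Z))) (ext_map f (amassoc bB X Y Z)))) => m m' m'' t.
  rewrite !amod_compE ext_mapE amassocE !ext_comul_homE !tmodmE !ext_comul_homE.
  by rewrite amassocE.
- move=> X; apply: amod_hom_ext.
  apply: (ext_tens_eq
    (g := amod_comp (amod_comp (amlunit bH (ext X))
       (tmodm bH ext_eps_hom (amod_id (ext X)))) (ext_comul_hom (umod bB) X))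
    (k := ext_map f (amlunit bB X))) => c m.
  by rewrite !amod_compE ext_mapE ext_comul_homE tmodmE ext_eps_homE !amlunitE bpureZr.
- move=> X; apply: amod_hom_ext.
  apply: (ext_tens_eq
    (g := amod_comp (amod_comp (amrunit bH (ext X))
       (tmodm bH (amod_id (ext X)) ext_eps_hom)) (ext_comul_hom X (umod bB)))
    (k := ext_map f (amrunit bB X))) => m c.
  by rewrite !amod_compE ext_mapE ext_comul_homE tmodmE ext_eps_homE !amrunitE bpureZr.
Qed.

Lemma ext_mul_opmonoidal : mul_opmonoidal (ext_bimonad fbi).
Proof.
split.
- move=> X Y; apply: amod_hom_ext.
  pose mu2 := tmodm bH (ext_counit f (ext X)) (ext_counit f (ext Y)).
  apply: (ext_hom_eq
    (g := amod_comp (ext_comul_hom X Y) (ext_counit f (ext (tmod bB X Y))))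
    (k := amod_comp (amod_comp mu2 (ext_comul_hom (res (ext X)) (res (ext Y))))
      (ext_map f (ext_comul fbi X Y)))) => t.
  rewrite !amod_compE ext_counitE ext_mapE.
  have muE (s : tmod bB (res (ext X)) (res (ext Y))) :
      mu2 (ext_comul_hom (res (ext X)) (res (ext Y)) (eta s)) = s.
    elim/tensor_ind: s => [u v|c s s' IHs IHs'].
      by rewrite ext_comul_homE tmodmE !ext_counitE.
    by rewrite bpurePr !linearP IHs IHs'.
  by rewrite muE.
- apply: amod_hom_ext.
  apply: (ext_hom_eq
    (g := amod_comp ext_eps_hom (ext_counit f (ext (umod bB))))
    (k := amod_comp ext_eps_hom (ext_map f (ext_eps fbi)))) => t.
  by rewrite !amod_compE ext_counitE ext_mapE ext_eps_homE.
Qed.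

Lemma ext_unit_opmonoidal : unit_opmonoidal (ext_bimonad fbi).
Proof.
split=> [X Y|]; apply: amod_hom_ext; last exact: ext_eps_homE.
elim/tensor_ind => [m n|c s t IHs IHt]; last by rewrite !linearP IHs IHt.
by rewrite [LHS]ext_comul_homE [RHS]tmodmE.
Qed.

Lemma ext_is_bimonad : is_bimonad (ext_bimonad fbi).
Proof.
split.
- exact: ext_is_monad.
- exact: ext_is_opmonoidal.
- exact: ext_mul_opmonoidal.
- exact: ext_unit_opmonoidal.
Qed.

(** The fusion operator with the free module H (x)_B Y replaced by an arbitrary
    H-module Z; its inverse only depends on the H-module structure. *)
Section Fusion.
Variables (X : amod B) (Z : amod H).

Definition fusion : amod_hom (ext (tmod bB X (res Z))) (tmod bH (ext X) Z) :=
  amod_comp (tmodm bH (amod_id (ext X)) (ext_counit f Z))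
    (ext_comul_hom X (res Z)).

Lemma fusionE (m : X) (z : Z) :
  fusion (eta (pure m z : tmod bB X (res Z))) = pure (eta m) z.
Proof. by rewrite amod_compE ext_comul_homE tmodmE ext_counitE. Qed.
End Fusion.
End ExtensionBimonad.

(** * Hom spaces and the internal Hom *)

Section HomSpace.
Variables (K : fieldType) (A : algType K) (M N : amod A).
Implicit Types g k : amod_hom M N.

HB.instance Definition _ := gen_eqMixin (amod_hom M N).
HB.instance Definition _ := gen_choiceMixin (amod_hom M N).

Let zeroJ a m : (\0 : {linear M -> N}) (act a m) = act a ((\0 : {linear M -> N}) m).
Proof. exact: (esym (linear0 (actl N a))). Qed.
Let addJ g k a m : (g \+ k) (act a m) = act a ((g \+ k) m).
Proof. by rewrite /= actDr !amod_funJ. Qed.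
Let oppJ g a m : (\- g) (act a m) = act a ((\- g) m).
Proof. by rewrite /= amod_funJ; exact: (esym (linearN (actl N a) _)). Qed.
Let scaleJ c g a m : (c \*: g) (act a m) = act a ((c \*: g) m).
Proof. by rewrite /= amod_funJ actZr. Qed.

Let hzero : amod_hom M N := AModHom zeroJ.
Let hadd g k : amod_hom M N := @AModHom K A M N (g \+ k) (@addJ g k).
Let hopp g : amod_hom M N := @AModHom K A M N (\- g) (@oppJ g).
Let hscale c g : amod_hom M N := @AModHom K A M N (c \*: g) (@scaleJ c g).

Fact hom_addA : associative hadd.
Proof. by move=> g k l; apply: amod_hom_ext => m; exact: addrA. Qed.
Fact hom_addC : commutative hadd.
Proof. by move=> g k; apply: amod_hom_ext => m; exact: addrC. Qed.
Fact hom_add0 : left_id hzero hadd.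
Proof. by move=> g; apply: amod_hom_ext => m; exact: add0r. Qed.
Fact hom_addN : left_inverse hzero hopp hadd.
Proof. by move=> g; apply: amod_hom_ext => m; exact: addNr. Qed.
HB.instance Definition _ :=
  GRing.isZmodule.Build (amod_hom M N) hom_addA hom_addC hom_add0 hom_addN.

Fact hom_scaleA a b g : hscale a (hscale b g) = hscale (a * b) g.
Proof. by apply: amod_hom_ext => m; exact: scalerA. Qed.
Fact hom_scale1 : left_id 1 hscale.
Proof. by move=> g; apply: amod_hom_ext => m; exact: scale1r. Qed.
Fact hom_scaleDr : right_distributive hscale +%R.
Proof. by move=> a g k; apply: amod_hom_ext => m; exact: scalerDr. Qed.
Fact hom_scaleDl g : {morph hscale^~ g : a b / a + b}.
Proof. by move=> a b; apply: amod_hom_ext => m; exact: scalerDl. Qed.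
HB.instance Definition _ :=
  GRing.Zmodule_isLmodule.Build K (amod_hom M N)
    hom_scaleA hom_scale1 hom_scaleDr hom_scaleDl.

Lemma hom_combE c g k m : (c *: g + k) m = c *: g m + k m.
Proof. by []. Qed.

Lemma hom_addE g k m : (g + k) m = g m + k m.
Proof. by []. Qed.
End HomSpace.

Section ActOrbit.
Variables (K : fieldType) (A : algType K) (M : amod A).

Definition act_orbit (m : M) : amod_hom (regular A) M :=
  @AModHom K A (regular A) M (mklinear ((act_bilinear M).1 m))
    (fun a b => actM a b m).
End ActOrbit.

(** The internal Hom of the monoidal category of B-modules: Hom_B(B (x) N, V), on
    which B acts through right multiplication on the factor B.  On
    Hom_K(N, V) one would need an antipode to define an action. *)
Section InternalHom.
Variables (K : fieldType) (B : algType K) (bB : bialgebra B) (N V : amod B).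
Local Notation BN := (tmod bB (regular B) N).

Definition ihom_act (b : B) (g : amod_hom BN V) : amod_hom BN V :=
  amod_comp g (tmodm bB (act_orbit (b : regular B)) (amod_id N)).

Lemma ihom_actE b g u n : ihom_act b g (pure u n) = g (pure (u * b) n).
Proof. by rewrite amod_compE tmodmE. Qed.

Lemma ihom_eq (g k : amod_hom BN V) :
  (forall u n, g (pure u n) = k (pure u n)) -> g = k.
Proof. move=> gk; apply: amod_hom_ext; exact: tensor_lin_ext. Qed.

Lemma ihom_act_bilinear : bilinear_for *:%R *:%R ihom_act.
Proof.
split=> [g k a b|b k g g']; apply: ihom_eq => u n.
  by rewrite hom_combE !ihom_actE mulrDr -scalerAr purePl linearP.
by rewrite !hom_combE !ihom_actE hom_combE.
Qed.

Lemma ihom_act1 g : ihom_act 1 g = g.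
Proof. by apply: ihom_eq => u n; rewrite ihom_actE mulr1. Qed.

Lemma ihom_actM a b g : ihom_act (a * b) g = ihom_act a (ihom_act b g).
Proof. by apply: ihom_eq => u n; rewrite !ihom_actE mulrA. Qed.

Definition ihom : amod B := AMod ihom_act_bilinear ihom_act1 ihom_actM.
End InternalHom.

(** * Invertibility of the fusion operators *)

Section FusionInverse.
Variables (K : fieldType) (B : algType K) (d : derivation B).
Variables (H : algType K) (f : {lrmorphism B -> H}) (x : H).
Hypothesis oreH : ore_extension d f x.
Variables (bB : bialgebra B) (bH : bialgebra H).
Hypothesis d_comul : forall b : B, comul bB (d b) =
  tmap d idfun (comul bB b) + tmap idfun d (comul bB b).
Hypothesis fbi : bialgebra_map bB bH f.
Hypothesis x_comul : comul bH x = pure x 1 + pure 1 x.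

Local Notation ext := (ext_mod f).
Local Notation res := (res_mod f).
Local Notation eta := (bpure f 1).

Section Commutator.
Variables Z V : amod H.
Local Notation BZ := (tmod bB (regular B) (res Z)).
Local Notation hom := (ihom bB (res Z) (res V)).

(* The action of x on B (x) Z, for B the H-module on which x acts by d. *)
Let D : {linear BZ -> BZ} := tprim d (actl Z x).

Let regular_derJ b (u : regular B) : d (act b u) = act b (d u : regular B) + act (d b) u.
Proof. by rewrite [LHS]derM addrC. Qed.

Let DJ b (t : BZ) : D (act b t) = act b (D t) + act (d b) t.
Proof. exact: (tprimJ d_comul regular_derJ (res_varJ oreH (N := Z))). Qed.

Let ad_lin (g : hom) : {linear BZ -> res V} := (actl V x \o g) \- (g \o D).

Let ad_lin_E (g : hom) t : ad_lin g t = act x (g t : V) - g (D t).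
Proof. by []. Qed.

Let ad_linJ (g : hom) b t : ad_lin g (act b t) = act b (ad_lin g t).
Proof.
rewrite !ad_lin_E DJ linearD !amod_funJ !res_modE actBr -!actM.
by rewrite (ore_ext_varM oreH) actDl [X in _ - X]addrC actM addrKA.
Qed.

(** The commutator of g with the action of x.  Its B-linearity comes from
    x b - d(b) = b x, the terms with d(b) cancelling between source and target. *)
Definition ad (g : hom) : hom := @AModHom K B BZ (res V) (ad_lin g) (ad_linJ g).

Lemma adE (g : hom) u z : ad g (pure u z) =
  act x (g (pure u z) : V) - g (pure (d u) z) - g (pure u (act x z)).
Proof. by rewrite [LHS]ad_lin_E tprimE linearD opprD addrA. Qed.

Lemma ad_linear : linear ad.
Proof.
move=> c g k; apply: ihom_eq => u z.
rewrite hom_combE !adE !hom_combE actPr.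
by rewrite !opprD -!scalerN [X in X + _ = _]addrACA -scalerDr addrACA -scalerDr.
Qed.

(** The commutator satisfies the rule that makes the internal Hom an H-module:
    right multiplication by b on B commutes with d up to right multiplication
    by d(b). *)
Lemma adJ b (g : hom) :
  mklinear ad_linear (act b g) = act b (mklinear ad_linear g : hom) + act (d b) g.
Proof.
apply: ihom_eq => u z.
rewrite hom_addE [LHS]adE !ihom_actE [ad g _]adE derM pureDl linearD.
by rewrite opprD addrA [X in _ = X + _]addrAC subrK.
Qed.

Definition ore_ihom : amod H := ore_amod oreH adJ.
End Commutator.

Section Inverse.
Variables (X : amod B) (Z : amod H).
Local Notation V := (ext (tmod bB X (res Z))).
Local Notation BZ := (tmod bB (regular B) (res Z)).
Local Notation E := (ore_ihom Z V).

(** The transpose m |-> (u (x) z |-> 1 (x) (u m (x) z)) of the unit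
    X (x) Z -> H (x)_B (X (x) Z) under the adjunction defining the internal Hom. *)
Definition coev_fun (m : X) : ihom bB (res Z) (res V) :=
  amod_comp (ext_unit f (tmod bB X (res Z))) (tmodm bB (act_orbit m) (amod_id (res Z))).

Lemma coevE (m : X) u (z : Z) :
  coev_fun m (pure u z) = eta (pure (act u m) z : tmod bB X (res Z)).
Proof. by rewrite amod_compE tmodmE. Qed.

Lemma coev_linear : linear coev_fun.
Proof.
move=> c m n; apply: ihom_eq => u z.
by rewrite hom_combE !coevE actPr purePl bpurePr.
Qed.

Lemma coevJ b m : coev_fun (act b m) = act (f b) (coev_fun m : E).
Proof.
rewrite ore_amod_base; apply: ihom_eq => u z.
by rewrite ihom_actE !coevE actM.
Qed.

Definition coev : amod_hom X (res E) :=
  @AModHom K B X (res E) (mklinear coev_linear) coevJ.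

Definition ext_coev : amod_hom (ext X) E :=
  amod_comp (ext_counit f E) (ext_map f coev).

Lemma ext_coevE m : ext_coev (eta m) = coev_fun m.
Proof. by rewrite amod_compE ext_mapE ext_counitE. Qed.

Definition fusion_inv_fun (t : ext X) (z : Z) : V :=
  (ext_coev t : amod_hom BZ (res V)) (pure 1 z).

Lemma fusion_inv_bilinear : bilinear_for *:%R *:%R fusion_inv_fun.
Proof.
split=> [z c s t|t c y z]; rewrite /fusion_inv_fun.
  by rewrite linearP hom_combE.
by rewrite purePr linearP.
Qed.

Definition fusion_inv_lin : {linear tmod bH (ext X) Z -> V} :=
  tlin fusion_inv_bilinear.

Lemma fusion_inv_linE t z : fusion_inv_lin (pure t z) = fusion_inv_fun t z.
Proof. exact: tlinE. Qed.

(** Since G(b t)(1 (x) z) = G(t)(b (x) z), applying the coproduct of b to t (x) z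
    amounts to letting b act diagonally on 1 (x) z, and G(t) is B-linear. *)
Lemma fusion_inv_base b (p : tmod bH (ext X) Z) :
  fusion_inv_lin (act (f b) p) = act (f b) (fusion_inv_lin p).
Proof.
elim/tensor_ind: p => [t z|c s t IHs IHt]; last first.
  by rewrite actPr !linearP IHs IHt actPr.
pose g : amod_hom BZ (res V) := ext_coev t.
transitivity (g (act b (pure 1 z : BZ))); last first.
  by rewrite amod_funJ res_modE fusion_inv_linE.
rewrite !tmodE fbi.1.
elim/tensor_ind: (comul bB b) => [a a'|c s s' IHs IHs'].
  rewrite tmapE !pact_pure fusion_inv_linE /fusion_inv_fun amod_funJ.
  by rewrite ore_amod_base ihom_actE mul1r -[a in LHS]mulr1.
by rewrite linearP !pactPl !linearP IHs IHs'.
Qed.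

(** The term G(t)(1 (x) x z) produced by 1 (x) x cancels the one produced by the
    commutator, and G(t)(d(1) (x) z) = 0. *)
Lemma fusion_inv_var (p : tmod bH (ext X) Z) :
  fusion_inv_lin (act x p) = act x (fusion_inv_lin p).
Proof.
elim/tensor_ind: p => [t z|c s t IHs IHt]; last first.
  by rewrite actPr !linearP IHs IHt actPr.
rewrite tmodE x_comul pactDl !pact_pure !act1 linearD !fusion_inv_linE.
rewrite /fusion_inv_fun amod_funJ ore_amod_var adE.
by rewrite der1 pure0l linear0 subr0 subrK.
Qed.

Definition fusion_inv : amod_hom (tmod bH (ext X) Z) V :=
  @AModHom K H (tmod bH (ext X) Z) V fusion_inv_lin
    (ore_equivariant oreH fusion_inv_base fusion_inv_var).

Lemma fusion_invE m z : fusion_inv (pure (eta m) z) = eta (pure m z : tmod bB X (res Z)).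
Proof. by rewrite [LHS]fusion_inv_linE /fusion_inv_fun ext_coevE coevE act1. Qed.

Lemma fusionK : cancel (fusion fbi X Z) fusion_inv.
Proof.
apply: (ext_tens_eq (g := amod_comp fusion_inv (fusion fbi X Z)) (k := amod_id _)) => m z.
by rewrite amod_compE fusionE fusion_invE.
Qed.

(** The composite is H-linear, so fixing t (x) z for all z forces it to fix
    x t (x) z = x (t (x) z) - t (x) x z; the case t = 1 (x) m is a direct
    computation. *)
Lemma fusion_invK : cancel fusion_inv (fusion fbi X Z).
Proof.
pose g := amod_comp (fusion fbi X Z) fusion_inv.
suff gE h m z : g (pure (bpure f h m) z) = pure (bpure f h m) z.
  elim/tensor_ind => [t z|c s t IHs IHt]; last by rewrite !linearP IHs IHt.
  elim/btensor_ind: t => [h m|c s t IHs IHt]; first exact: gE.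
  by rewrite purePl !linearP IHs IHt.
have bpureD u v : bpure f (u + v) m = bpure f u m + bpure f v m.
  exact: (linearD (mklinear ((bpure_bilinear f X).1 m))).
elim/(ore_ext_ind oreH): h z => [b|u IH|u v IHu IHv] z.
- by rewrite -[f b]mul1r bpure_balanced amod_compE fusion_invE fusionE.
- have xE : act x (pure (bpure f u m) z : tmod bH (ext X) Z) =
      pure (bpure f (x * u) m) z + pure (bpure f u m) (act x z).
    by rewrite tmodE x_comul pactDl !pact_pure !act1 ext_modE.
  apply: (addIr (pure (bpure f u m) (act x z))).
  by rewrite -xE -[in RHS]IH -amod_funJ xE linearD IH.
- by rewrite bpureD pureDl linearD IHu IHv.
Qed.
End Inverse.

(** The fusion operator at (X, Y) is [fusion X (H (x)_B Y)]. *)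
Lemma ext_is_left_hopf : is_left_hopf_monad (ext_bimonad fbi).
Proof.
split=> [|X Y]; first exact: ext_is_bimonad.
pose F : amod_hom (res (ext (tmod bB X (res (ext Y)))))
    (tmod bB (res (ext X)) (res (ext Y))) := left_fusion (ext_bimonad fbi) X Y.
apply: (@iso_intro K B _ _ F (fusion_inv X (ext Y))).
  exact: (@fusionK X (ext Y)).
exact: (@fusion_invK X (ext Y)).
Qed.
End FusionInverse.

Theorem theorem4p12 (K : fieldType) (B : algType K) (bB : bialgebra B)
    (d : derivation B)
    (d_comul : forall b : B, comul bB (d b) =
       tmap d idfun (comul bB b) + tmap idfun d (comul bB b))
    (d_counit : forall b : B, counit bB (d b) = 0) :
  exists bH : bialgebra (ore d),
    [/\ comul bH (ore_var d) = pure (ore_var d) 1 + pure 1 (ore_var d),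
        counit bH (ore_var d) = 0
      & exists f_bialg : bialgebra_map bB bH (ore_base d : {lrmorphism B -> ore d}),
          is_left_hopf_monad (ext_bimonad f_bialg)].
Proof.
pose oreH := ore_presentation d.
exists (ore_bialgebra oreH d_comul d_counit); split.
- exact: ore_comul_var.
- exact: ore_counit_var.
exists (ore_bialgebra_map oreH d_comul d_counit).
apply: (ext_is_left_hopf oreH d_comul); exact: ore_comul_var.
Qed.
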